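(* Let the system $x_{t+1}=f(x_t,u_t)$, $y_t=h(x_t)$ admit a Koopman linear embedding, with observable realization $(A,B,C)$ of dimension $\eta$, lag $\ell$ and lifted linear system $\xi_{t+1}=A\xi_t+Bu_t$, $y_t=C\xi_t$. Consider the cost $J=\sum_{t=0}^\infty y_t^\top Q y_t+u_t^\top R u_t$ with $Q,R\succ 0$. Assume that: (1) the nonlinear system is stabilizable and detectable (in the sense given in the context); (2) there exists a full row rank matrix $T$ such that $\xi_t=Tz_t$ for any state $\xi_t$ of the lifted linear system, where $z_t=\begin{bmatrix} u_{[t-\ell,t-1]} \\ \Gamma y_{[t-\ell,t-1]}\end{bmatrix}\in\mathbb{R}^{m\ell+\eta}$ and $\Gamma$ is the matrix constructed from persistently excited data by Algorithm 1 (see context). Then there is a matrix $\bar K^*\in\mathbb{R}^{m\times(m\ell+\eta)}$ such that the control input $u_t^*=-\bar K^* z_t$ stabilizes the nonlinear system and minimizes the cost $J$. Moreover, at every iteration $i=0,1,2,\ldots$ of Algorithm 2 (see context, initialized with a stabilizing $K^0$), the equation $$Z^\top\Theta^{i+1}Z=W^\top\bar Q W+\Sigma_i^\top\Theta^{i+1}\Sigma_i$$ has a unique solution $\Theta^{i+1}$, the input $u_t^i=-K^i z_t$ stabilizes the nonlinear system, and the algorithm converges quadratically, with $\lim_{i\to\infty}K^i=\bar K^*$.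
   Context: **System.** $x_t\in\mathbb{R}^n$, $u_t\in\mathbb{R}^m$, $y_t\in\mathbb{R}^p$; $f:\mathbb{R}^n\times\mathbb{R}^m\to\mathbb{R}^n$ and $h:\mathbb{R}^n\to\mathbb{R}^p$ are continuous with $f(0,0)=0$, $h(0)=0$. **Stabilizable and detectable.** Stabilizable: for every $x_0\in\mathbb{R}^n$ there is a control sequence $\{u_t\}_{t=0}^\infty$ such that $x_t\to0$ as $t\to\infty$. Detectable: $y_t\to0$ as $t\to\infty$ implies $x_t\to0$. **Koopman linear embedding (KLE).** The system admits a KLE if there exist $\eta\in\mathbb{N}$, matrices $A\in\mathbb{R}^{\eta\times\eta}$, $B\in\mathbb{R}^{\eta\times m}$, $C\in\mathbb{R}^{p\times\eta}$, and linearly independent functions $\psi_1,\dots,\psi_\eta:\mathbb{R}^n\to\mathbb{R}$ such that, with $\Psi=[\psi_1\ \cdots\ \psi_\eta]^\top$, every trajectory of the system (any initial state, any input sequence) satisfies $\Psi(x_{t+1})=A\Psi(x_t)+Bu_t$ and $y_t=C\Psi(x_t)$ for all $t$. A realization is observable if the pair $(A,C)$ is observable. The lag $\ell$ is the observability index, i.e. the smallest integer such that $[C^\top\ (CA)^\top\cdots(CA^{\ell-1})^\top]^\top$ has rank $\eta$. **Notation.** $u_{[a,b]}=[u_a^\top\ \cdots\ u_b^\top]^\top$, and similarly for $y$. The controller $u_t=-Kz_t$ is applied for $t\ge0$, with $z_0$ formed from the $\ell$ input-output samples of the system preceding time $0$. ''Stabilizes the nonlinear system'' means $x_t\to0$ as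 $t\to\infty$ for every initial condition. ''Minimizes the cost'' means that for every initial condition no other input achieves a smaller value of $J$. ''Converges quadratically'' means that there is a constant $c$ with $\|K^{i+1}-\bar K^*\|\le c\|K^i-\bar K^*\|^2$ for all $i$. **Persistently excited data.** $\mathcal{D}=\{\{u_t^j,y_t^j\}_{t=0}^{\ell},\ j=1,\dots,\nu\}$ is a set of $\nu$ input-output trajectories of length $\ell+1$ of the nonlinear system. It is persistently excited of order $\eta+\ell+1$ if $$\operatorname{rank}\begin{bmatrix} u^1_{[0,\ell]}&\cdots&u^\nu_{[0,\ell]} \\ y^1_{[0,\ell-1]}&\cdots&y^\nu_{[0,\ell-1]}\end{bmatrix}=m(\ell+1)+\eta.$$ **Algorithm 1 (construction of $\Gamma$).** Take data $\mathcal{D}$ persistently excited of order $\eta+\ell+1$ and form $$\mathcal{H}^-_{\mathcal D}=\begin{bmatrix} u^1_{[0,\ell-1]}&\cdots&u^\nu_{[0,\ell-1]} \\ y^1_{[0,\ell-1]}&\cdots&y^\nu_{[0,\ell-1]}\end{bmatrix}.$$ Choose a permutation matrix $\Pi\in\mathbb{R}^{p\ell\times p\ell}$ such that $\mathcal{H}^-_{\mathcal D}=\begin{bmatrix} I_{m\ell}&0 \\ 0&\Pi\end{bmatrix}\begin{bmatrix} M \\ N\end{bmatrix}$, where $M\in\mathbb{R}^{(m\ell+\eta)\times\nu}$ has full row rank and $N\in\mathbb{R}^{(p\ell-\eta)\times\nu}$. Let $\Gamma\in\mathbb{R}^{\eta\times p\ell}$ consist of the first $\eta$ rows of $\Pi^{-1}$.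 **Realization in $z$.** Under hypothesis (2), there are matrices $(\bar A,\bar B,\bar C)$ such that $z_{t+1}=\bar Az_t+\bar Bu_t$, $y_t=\bar Cz_t$ holds along trajectories. **Algorithm 2.** - With the same data $\mathcal{D}$ and $\Gamma$, form $z^j_\ell$ and $z^j_{\ell+1}$ from the $j$-th trajectory, $j=1,\dots,\nu$, by the definition of $z_t$. - Let $\mu=m(\ell+1)+\eta$ and choose indices $k_1,\dots,k_\mu\in\{1,\dots,\nu\}$ such that $Z=\begin{bmatrix} z_\ell^{k_1}&\cdots&z_\ell^{k_\mu} \\ u_\ell^{k_1}&\cdots&u_\ell^{k_\mu}\end{bmatrix}\in\mathbb{R}^{\mu\times\mu}$ is nonsingular (such a choice is always possible for persistently excited data). - Set $W=\begin{bmatrix} y_\ell^{k_1}&\cdots&y_\ell^{k_\mu} \\ u_\ell^{k_1}&\cdots&u_\ell^{k_\mu}\end{bmatrix}\in\mathbb{R}^{(m+p)\times\mu}$ and $\bar Q=\begin{bmatrix} Q&0 \\ 0&R\end{bmatrix}$. - Choose $K^0\in\mathbb{R}^{m\times(m\ell+\eta)}$ stabilizing, i.e. $\bar A-\bar BK^0$ is Schur (all eigenvalues in the open unit disc). - For $i=0,1,2,\dots$: set $\Sigma_i=\begin{bmatrix} z_{\ell+1}^{k_1}&\cdots&z_{\ell+1}^{k_\mu} \\ -K^iz_{\ell+1}^{k_1}&\cdots&-K^iz_{\ell+1}^{k_\mu}\end{bmatrix}\in\mathbb{R}^{\mu\times\mu}$; solve $Z^\top\Theta^{i+1}Z=W^\top\bar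 QW+\Sigma_i^\top\Theta^{i+1}\Sigma_i$ for $\Theta^{i+1}\in\mathbb{R}^{\mu\times\mu}$; partition $\Theta^{i+1}=\begin{bmatrix} \Theta^{i+1}_{zz}&(\Theta^{i+1}_{uz})^\top \\ \Theta^{i+1}_{uz}&\Theta^{i+1}_{uu}\end{bmatrix}$ with $\Theta_{uz}^{i+1}\in\mathbb{R}^{m\times(m\ell+\eta)}$, $\Theta_{uu}^{i+1}\in\mathbb{R}^{m\times m}$; set $K^{i+1}=(\Theta^{i+1}_{uu})^{-1}\Theta^{i+1}_{uz}$. All of $Q,R$ are symmetric. *)

(* Defs.v *)
From HB Require Import structures.
From mathcomp Require Import all_boot all_order all_algebra.
From mathcomp Require Import complex.
From mathcomp Require Import all_classical all_reals all_analysis.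
Set Implicit Arguments.
Unset Strict Implicit.
Unset Printing Implicit Defensive.
Import Order.TTheory GRing.Theory Num.Theory.
Import numFieldNormedType.Exports.
Local Open Scope classical_set_scope.
Local Open Scope ring_scope.

(* Number of rows of a stack of [k] blocks with [q] rows each, i.e. [q * k],
   in the form produced by [\mxcol]. *)
Notation stackdim q k := (\sum_(i < k) q)%N.

(* [w_{[a, a+k-1]}]: the [k] samples starting at time [a], stacked. *)
Definition window (R : realType) (q : nat) (w : nat -> 'cV[R]_q) (a k : nat) :
    'cV[R]_(stackdim q k) :=
  \mxcol_(i < k) w (a + i)%N.

Definition hcat (R : realType) (q k : nat) (v : 'I_k -> 'cV[R]_q) :
    'M[R]_(q, k) :=
  \matrix_(i, j) v j i ord0.

Definition quadform (R : realType) (q : nat) (M : 'M[R]_q) (v : 'cV[R]_q) : R :=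
  (v^T *m M *m v) ord0 ord0.

Definition posdefmx (R : realType) (q : nat) (M : 'M[R]_q) : Prop :=
  forall v : 'cV[R]_q, v != 0 -> 0 < quadform M v.

(* [R[i]] is the field of complex numbers over [R]. *)
Definition schur (R : realType) (q : nat) (M : 'M[R]_q) : Prop :=
  forall lam : R[i], eigenvalue (map_mx (real_complex R) M) lam -> `|lam| < 1.

Definition sys_traj (R : realType) (n m p : nat)
    (f : 'cV[R]_n -> 'cV[R]_m -> 'cV[R]_n) (h : 'cV[R]_n -> 'cV[R]_p)
    (x : nat -> 'cV[R]_n) (u : nat -> 'cV[R]_m) (y : nat -> 'cV[R]_p) : Prop :=
  forall t, x t.+1 = f (x t) (u t) /\ y t = h (x t).

Definition stabilizable (R : realType) (n m : nat)
    (f : 'cV[R]_n -> 'cV[R]_m -> 'cV[R]_n) : Prop :=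
  forall x0 : 'cV[R]_n, exists (x : nat -> 'cV[R]_n) (u : nat -> 'cV[R]_m),
    [/\ x 0%N = x0, forall t, x t.+1 = f (x t) (u t)
      & x @ \oo --> (0 : 'cV[R]_n)].

(* The implication is required along every trajectory, whatever its input. *)
Definition detectable (R : realType) (n m p : nat)
    (f : 'cV[R]_n -> 'cV[R]_m -> 'cV[R]_n) (h : 'cV[R]_n -> 'cV[R]_p) : Prop :=
  forall (x : nat -> 'cV[R]_n) (u : nat -> 'cV[R]_m) (y : nat -> 'cV[R]_p),
    sys_traj f h x u y ->
    y @ \oo --> (0 : 'cV[R]_p) -> x @ \oo --> (0 : 'cV[R]_n).

Definition lift_state (R : realType) (n eta : nat)
    (psi : 'I_eta -> 'cV[R]_n -> R) (x : 'cV[R]_n) : 'cV[R]_eta :=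
  \col_i psi i x.

Definition lin_indep_fun (R : realType) (n eta : nat)
    (psi : 'I_eta -> 'cV[R]_n -> R) : Prop :=
  forall c : 'I_eta -> R,
    (forall x, \sum_i c i * psi i x = 0) -> forall i, c i = 0.

Definition koopman_embedding (R : realType) (n m p eta : nat)
    (f : 'cV[R]_n -> 'cV[R]_m -> 'cV[R]_n) (h : 'cV[R]_n -> 'cV[R]_p)
    (psi : 'I_eta -> 'cV[R]_n -> R)
    (A : 'M[R]_eta) (B : 'M[R]_(eta, m)) (C : 'M[R]_(p, eta)) : Prop :=
  lin_indep_fun psi /\
  forall (x : nat -> 'cV[R]_n) (u : nat -> 'cV[R]_m) (y : nat -> 'cV[R]_p),
    sys_traj f h x u y ->
    forall t,
      lift_state psi (x t.+1) = A *m lift_state psi (x t) + B *m u t /\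
      y t = C *m lift_state psi (x t).

Definition lifted_traj (R : realType) (m p eta : nat)
    (A : 'M[R]_eta) (B : 'M[R]_(eta, m)) (C : 'M[R]_(p, eta))
    (xi : nat -> 'cV[R]_eta) (u : nat -> 'cV[R]_m) (y : nat -> 'cV[R]_p) :
    Prop :=
  forall t, xi t.+1 = A *m xi t + B *m u t /\ y t = C *m xi t.

(* The block column [C; CA; ...; CA^(k-1)]. *)
Definition obsmx (R : realType) (p eta : nat)
    (A : 'M[R]_eta) (C : 'M[R]_(p, eta)) (k : nat) :
    'M[R]_(stackdim p k, eta) :=
  \mxcol_(i < k) (C *m A ^+ i).

Definition observable (R : realType) (p eta : nat)
    (A : 'M[R]_eta) (C : 'M[R]_(p, eta)) : Prop :=
  \rank (obsmx A C eta) = eta.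

Definition is_lag (R : realType) (p eta : nat)
    (A : 'M[R]_eta) (C : 'M[R]_(p, eta)) (l : nat) : Prop :=
  \rank (obsmx A C l) = eta /\
  forall k, \rank (obsmx A C k) = eta -> (l <= k)%N.

(* [z_t]; meaningful for [l <= t] only, since [t - l] is truncated. *)
Definition zvec (R : realType) (m p eta l : nat)
    (Gamma : 'M[R]_(eta, stackdim p l))
    (u : nat -> 'cV[R]_m) (y : nat -> 'cV[R]_p) (t : nat) :
    'cV[R]_(stackdim m l + eta) :=
  col_mx (window u (t - l) l) (Gamma *m window y (t - l) l).

(* [nu] input-output trajectories of length [l + 1]; the values of
   [ud j], [yd j] at times larger than [l] are irrelevant. *)
Definition data_traj (R : realType) (n m p l nu : nat)
    (f : 'cV[R]_n -> 'cV[R]_m -> 'cV[R]_n) (h : 'cV[R]_n -> 'cV[R]_p)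
    (ud : 'I_nu -> nat -> 'cV[R]_m) (yd : 'I_nu -> nat -> 'cV[R]_p) : Prop :=
  forall j, exists x : nat -> 'cV[R]_n,
    (forall t, (t < l)%N -> x t.+1 = f (x t) (ud j t)) /\
    (forall t, (t <= l)%N -> yd j t = h (x t)).

(* Persistent excitation of order [eta + l + 1]. *)
Definition persistently_excited (R : realType) (m p eta l nu : nat)
    (ud : 'I_nu -> nat -> 'cV[R]_m) (yd : 'I_nu -> nat -> 'cV[R]_p) : Prop :=
  \rank (col_mx (hcat (fun j => window (ud j) 0 l.+1))
                (hcat (fun j => window (yd j) 0 l))) = (m * l.+1 + eta)%N.

Definition past_data (R : realType) (m p l nu : nat)
    (ud : 'I_nu -> nat -> 'cV[R]_m) (yd : 'I_nu -> nat -> 'cV[R]_p) :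
    'M[R]_(stackdim m l + stackdim p l, nu) :=
  col_mx (hcat (fun j => window (ud j) 0 l)) (hcat (fun j => window (yd j) 0 l)).

(* [Gamma] is a possible outcome of the construction: it depends on the choice
   of the permutation matrix [Pi]. The equation [e] only serves to cast
   between [eta + (p l - eta)] and [p l] rows. *)
Definition gamma_from_data (R : realType) (m p eta l nu : nat)
    (ud : 'I_nu -> nat -> 'cV[R]_m) (yd : 'I_nu -> nat -> 'cV[R]_p)
    (Gamma : 'M[R]_(eta, stackdim p l)) : Prop :=
  exists (e : (eta + (stackdim p l - eta) = stackdim p l)%N)
         (Pi : 'M[R]_(stackdim p l))
         (M : 'M[R]_(stackdim m l + eta, nu))
         (N : 'M[R]_(stackdim p l - eta, nu)),
    [/\ is_perm_mx Pi,
        past_data l ud yd =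
          block_mx 1%:M 0 0 Pi *m
          castmx (etrans (esym (addnA _ _ _)) (congr1 (addn _) e), erefl)
                 (col_mx M N),
        row_free M
      & Gamma = usubmx (castmx (esym e, erefl) (invmx Pi))].

(* Along trajectories indexed by [nat], the time origin of the control problem
   is shifted by [l]: times [0, ..., l-1] carry the [l] samples preceding the
   control, and the controller acts from time [l] on. *)
Definition closed_loop (R : realType) (n m p eta l : nat)
    (f : 'cV[R]_n -> 'cV[R]_m -> 'cV[R]_n) (h : 'cV[R]_n -> 'cV[R]_p)
    (Gamma : 'M[R]_(eta, stackdim p l)) (K : 'M[R]_(m, stackdim m l + eta))
    (x : nat -> 'cV[R]_n) (u : nat -> 'cV[R]_m) (y : nat -> 'cV[R]_p) : Prop :=
  sys_traj f h x u y /\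
  forall t, (l <= t)%N -> u t = - (K *m zvec Gamma u y t).

Definition stabilizes (R : realType) (n m p eta l : nat)
    (f : 'cV[R]_n -> 'cV[R]_m -> 'cV[R]_n) (h : 'cV[R]_n -> 'cV[R]_p)
    (Gamma : 'M[R]_(eta, stackdim p l)) (K : 'M[R]_(m, stackdim m l + eta)) :
    Prop :=
  forall (x : nat -> 'cV[R]_n) (u : nat -> 'cV[R]_m) (y : nat -> 'cV[R]_p),
    closed_loop f h Gamma K x u y -> x @ \oo --> (0 : 'cV[R]_n).

(* Extended-real valued: the cost of a trajectory may be [+oo]. *)
Definition cost (R : realType) (m p : nat) (Q : 'M[R]_p) (Ru : 'M[R]_m)
    (l : nat) (u : nat -> 'cV[R]_m) (y : nat -> 'cV[R]_p) : \bar R :=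
  (\sum_(l <= t <oo) (quadform Q (y t) + quadform Ru (u t))%:E)%E.

(* The competitor starts from the same state when the control starts, and is
   driven by an arbitrary input from then on. *)
Definition minimizes_cost (R : realType) (n m p eta l : nat)
    (f : 'cV[R]_n -> 'cV[R]_m -> 'cV[R]_n) (h : 'cV[R]_n -> 'cV[R]_p)
    (Q : 'M[R]_p) (Ru : 'M[R]_m)
    (Gamma : 'M[R]_(eta, stackdim p l)) (K : 'M[R]_(m, stackdim m l + eta)) :
    Prop :=
  forall (x : nat -> 'cV[R]_n) (u : nat -> 'cV[R]_m) (y : nat -> 'cV[R]_p),
    closed_loop f h Gamma K x u y ->
    forall (x' : nat -> 'cV[R]_n) (u' : nat -> 'cV[R]_m) (y' : nat -> 'cV[R]_p),
      sys_traj f h x' u' y' -> x' l = x l ->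
      (cost Q Ru l u y <= cost Q Ru l u' y')%E.

Definition z_realization (R : realType) (n m p eta l : nat)
    (f : 'cV[R]_n -> 'cV[R]_m -> 'cV[R]_n) (h : 'cV[R]_n -> 'cV[R]_p)
    (Gamma : 'M[R]_(eta, stackdim p l))
    (Abar : 'M[R]_(stackdim m l + eta)) (Bbar : 'M[R]_(stackdim m l + eta, m))
    (Cbar : 'M[R]_(p, stackdim m l + eta)) : Prop :=
  forall (x : nat -> 'cV[R]_n) (u : nat -> 'cV[R]_m) (y : nat -> 'cV[R]_p),
    sys_traj f h x u y ->
    forall t, (l <= t)%N ->
      zvec Gamma u y t.+1 = Abar *m zvec Gamma u y t + Bbar *m u t /\
      y t = Cbar *m zvec Gamma u y t.

Definition stabilizing_gain (R : realType) (n m p eta l : nat)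
    (f : 'cV[R]_n -> 'cV[R]_m -> 'cV[R]_n) (h : 'cV[R]_n -> 'cV[R]_p)
    (Gamma : 'M[R]_(eta, stackdim p l)) (K : 'M[R]_(m, stackdim m l + eta)) :
    Prop :=
  exists (Abar : 'M[R]_(stackdim m l + eta))
         (Bbar : 'M[R]_(stackdim m l + eta, m))
         (Cbar : 'M[R]_(p, stackdim m l + eta)),
    z_realization f h Gamma Abar Bbar Cbar /\ schur (Abar - Bbar *m K).

(* [mu = m (l + 1) + eta], in the form of the row dimension of [z; u]. *)
Notation mudim m l eta := (stackdim m l + eta + m)%N.

Definition Zmx (R : realType) (m p eta l nu mu : nat)
    (Gamma : 'M[R]_(eta, stackdim p l))
    (ud : 'I_nu -> nat -> 'cV[R]_m) (yd : 'I_nu -> nat -> 'cV[R]_p)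
    (k : 'I_mu -> 'I_nu) : 'M[R]_(mudim m l eta, mu) :=
  hcat (fun j => col_mx (zvec Gamma (ud (k j)) (yd (k j)) l) (ud (k j) l)).

Definition Wmx (R : realType) (m p nu mu : nat) (l : nat)
    (ud : 'I_nu -> nat -> 'cV[R]_m) (yd : 'I_nu -> nat -> 'cV[R]_p)
    (k : 'I_mu -> 'I_nu) : 'M[R]_(p + m, mu) :=
  hcat (fun j => col_mx (yd (k j) l) (ud (k j) l)).

Definition Sigmamx (R : realType) (m p eta l nu mu : nat)
    (Gamma : 'M[R]_(eta, stackdim p l))
    (ud : 'I_nu -> nat -> 'cV[R]_m) (yd : 'I_nu -> nat -> 'cV[R]_p)
    (k : 'I_mu -> 'I_nu) (K : 'M[R]_(m, stackdim m l + eta)) :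
    'M[R]_(mudim m l eta, mu) :=
  hcat (fun j =>
    let z := zvec Gamma (ud (k j)) (yd (k j)) l.+1 in col_mx z (- (K *m z))).

Definition theta_eq (R : realType) (m p eta l nu : nat)
    (Q : 'M[R]_p) (Ru : 'M[R]_m) (Gamma : 'M[R]_(eta, stackdim p l))
    (ud : 'I_nu -> nat -> 'cV[R]_m) (yd : 'I_nu -> nat -> 'cV[R]_p)
    (k : 'I_(mudim m l eta) -> 'I_nu) (K : 'M[R]_(m, stackdim m l + eta))
    (Theta : 'M[R]_(mudim m l eta)) : Prop :=
  let Z := Zmx Gamma ud yd k in
  let W := Wmx l ud yd k in
  let Sigma := Sigmamx Gamma ud yd k K in
  Z^T *m Theta *m Z =
    W^T *m block_mx Q 0 0 Ru *m W + Sigma^T *m Theta *m Sigma.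

Definition gain_update (R : realType) (m q : nat)
    (Theta : 'M[R]_(q + m)) (K : 'M[R]_(m, q)) : Prop :=
  exists (Tzz : 'M[R]_q) (Tuz : 'M[R]_(m, q)) (Tuu : 'M[R]_m),
    [/\ Theta = block_mx Tzz Tuz^T Tuz Tuu, Tuu \in unitmx
      & K = invmx Tuu *m Tuz].

(* [Theta 0] is not used. *)
Definition algorithm_run (R : realType) (m p eta l nu : nat)
    (Q : 'M[R]_p) (Ru : 'M[R]_m) (Gamma : 'M[R]_(eta, stackdim p l))
    (ud : 'I_nu -> nat -> 'cV[R]_m) (yd : 'I_nu -> nat -> 'cV[R]_p)
    (k : 'I_(mudim m l eta) -> 'I_nu) (K0 : 'M[R]_(m, stackdim m l + eta))
    (K : nat -> 'M[R]_(m, stackdim m l + eta))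
    (Theta : nat -> 'M[R]_(mudim m l eta)) : Prop :=
  K 0%N = K0 /\
  forall i, theta_eq Q Ru Gamma ud yd k (K i) (Theta i.+1) /\
            gain_update (Theta i.+1) (K i.+1).

(* Main.v *)
Require Import Defs.
From HB Require Import structures.
From mathcomp Require Import all_boot all_order all_algebra.
From mathcomp Require Import complex.
From mathcomp Require Import all_classical all_reals all_analysis.
From mathcomp Require Import ring lra.
Set Implicit Arguments.
Unset Strict Implicit.
Unset Printing Implicit Defensive.
Import Order.TTheory GRing.Theory Num.Theory.
Import numFieldNormedType.Exports.
Local Open Scope classical_set_scope.
Local Open Scope ring_scope.

(** Full row rank of the data matrix [M] makes [z_t] an invertible linear image of
    the past inputs and of the lifted state [l] steps earlier; hence [z] obeys a
    linear system whose coefficients the data determine, and [u, y -> 0] forces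
    [z -> 0]. Observability writes the embedding as a linear image of finitely many
    unforced outputs, so it is continuous and vanishes at [0]: stabilizability of
    the nonlinear system passes to the lifted system and then to [z].

    For the linear-quadratic problem in [z], value iteration is monotone and, by
    dynamic programming along inputs steering a basis to [0], bounded; its limit
    [P*] gives the optimal gain. The equation of Algorithm 2 reads
    [Theta = Qtilde + [A B]^T P [A B]], with [P] the solution of the Lyapunov
    equation of the current closed loop, so the algorithm is Hewer's policy
    iteration: [P_i] decreases to [P*], [P_i - P*] is quadratic in [K_i - K*], and
    [K_(i+1) - K*] is linear in [P_i - P*]. *)

(** * Limits of matrices *)

Section MatrixLimits.
Variable R : realType.

Lemma entry_le_norm (a b : nat) (M : 'M[R]_(a, b)) i j : `|M i j| <= `|M|.
Proof.
rewrite /Num.norm/= mx_normrE.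
exact: (le_bigmax _ (fun ij : 'I_a * 'I_b => `|M ij.1 ij.2|) (i, j)).
Qed.

Lemma mx_norm_le (a b : nat) (M : 'M[R]_(a, b)) (c : R) :
  0 <= c -> (forall i j, `|M i j| <= c) -> `|M| <= c.
Proof.
move=> c0 Mc; rewrite /Num.norm/= mx_normrE.
by apply: bigmax_le => // -[i j] _; exact: Mc.
Qed.

(** The norm is the maximum of the moduli of the entries, and finitely many eventual bounds hold
    simultaneously. *)
Lemma cvg_mxP (a b : nat) (M : nat -> 'M[R]_(a, b)) (L : 'M[R]_(a, b)) :
  (M @ \oo --> L) <-> (forall i j, (fun k => M k i j) @ \oo --> L i j).
Proof.
split=> [ML i j|ML].
  exact: (continuous_cvg _ (@coord_continuous R a b i j L) ML).
apply/cvgrPdist_le => e e0.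
have : \forall k \near \oo, forall ij : 'I_a * 'I_b,
    `|L ij.1 ij.2 - M k ij.1 ij.2| <= e.
  by apply: filter_forall => -[i j]; move/cvgrPdist_le: (ML i j); exact.
apply: filterS => k Mk; apply: mx_norm_le; first exact: ltW.
by move=> i j; rewrite !mxE; exact: (Mk (i, j)).
Qed.

Lemma cvg_sum (I : finType) (u : I -> nat -> R) (l : I -> R) :
  (forall i, u i @ \oo --> l i) ->
  (fun k => \sum_i u i k) @ \oo --> \sum_i l i.
Proof.
move=> ul; elim: (index_enum I) => [|x s IH].
  by rewrite big_nil; under eq_fun do rewrite big_nil; exact: cvg_cst.
rewrite big_cons.
under [X in X @ _]eq_fun do rewrite big_cons.
by apply: cvgD.
Qed.

Lemma cvg_mulmx (a b c : nat) (M : nat -> 'M[R]_(a, b)) (N : nat -> 'M[R]_(b, c))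
    (L : 'M[R]_(a, b)) (L' : 'M[R]_(b, c)) :
  M @ \oo --> L -> N @ \oo --> L' -> (fun k => M k *m N k) @ \oo --> L *m L'.
Proof.
move=> /cvg_mxP ML /cvg_mxP NL; apply/cvg_mxP => i j.
under eq_fun do rewrite mxE.
rewrite mxE.
by apply: cvg_sum => x; apply: cvgM.
Qed.

Lemma cvg_mulmxr (a b c : nat) (M : 'M[R]_(a, b)) (N : nat -> 'M[R]_(b, c))
    (L : 'M[R]_(b, c)) :
  N @ \oo --> L -> (fun k => M *m N k) @ \oo --> M *m L.
Proof. by apply: cvg_mulmx; exact: cvg_cst. Qed.

Lemma cvg_trmx (a b : nat) (M : nat -> 'M[R]_(a, b)) (L : 'M[R]_(a, b)) :
  M @ \oo --> L -> (fun k => (M k)^T) @ \oo --> L^T.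
Proof.
move=> /cvg_mxP ML; apply/cvg_mxP => i j; under eq_fun do rewrite mxE.
by rewrite mxE; exact: ML.
Qed.

Lemma cvg_col_mx (a b c : nat)
    (M : nat -> 'M[R]_(a, c)) (N : nat -> 'M[R]_(b, c))
    (L : 'M[R]_(a, c)) (L' : 'M[R]_(b, c)) :
  M @ \oo --> L -> N @ \oo --> L' ->
  (fun k => col_mx (M k) (N k)) @ \oo --> col_mx L L'.
Proof.
move=> /cvg_mxP ML /cvg_mxP NL; apply/cvg_mxP => i j; rewrite mxE.
under eq_fun do rewrite mxE.
by case: (fintype.split i) => k; [exact: ML|exact: NL].
Qed.

Lemma mulmx_norm_le (a b c : nat) (M : 'M[R]_(a, b)) (N : 'M[R]_(b, c)) :
  `|M *m N| <= b%:R * (`|M| * `|N|).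
Proof.
apply: mx_norm_le; first by rewrite !mulr_ge0.
move=> i j; rewrite mxE (le_trans (ler_norm_sum _ _ _))//.
have -> : b%:R * (`|M| * `|N|) = \sum_(k < b) `|M| * `|N|.
  by rewrite sumr_const card_ord mulr_natl.
by apply: ler_sum => k _; rewrite normrM ler_pM ?entry_le_norm.
Qed.


Lemma trmx_mul_self (a : nat) (v : 'cV[R]_a) : (v^T *m v) 0 0 = \sum_i v i 0 ^+ 2.
Proof. by rewrite mxE; apply: eq_bigr => i _; rewrite mxE expr2. Qed.

Lemma squeeze_cvg0 (a b : nat -> R) : (forall k, 0 <= a k <= b k) ->
  b @ \oo --> (0 : R) -> a @ \oo --> (0 : R).
Proof.
move=> ab b0; apply: (squeeze_cvgr _ (cvg_cst (0 : R)) b0).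
by near=> k; exact: ab.
Unshelve. all: by end_near.
Qed.

Lemma sqr_norm_cvg0 (a b : nat) (v : nat -> 'M[R]_(a, b)) :
  (fun k => `|v k| ^+ 2) @ \oo --> (0 : R) -> v @ \oo --> (0 : 'M[R]_(a, b)).
Proof.
move=> v0; apply/norm_cvg0P.
have -> : (fun k => `|v k|) = Num.sqrt \o (fun k => `|v k| ^+ 2).
  by apply: funext => k /=; rewrite sqrtr_sqr normr_id.
by rewrite -[X in _ --> X](@sqrtr0 R); exact: continuous_cvg (@sqrt_continuous R 0) v0.
Qed.

Lemma nonincreasing_diff_cvg0 (a : nat -> R) :
  (forall k, 0 <= a k) -> (forall k, a k.+1 <= a k) ->
  (fun k => a k - a k.+1) @ \oo --> (0 : R).
Proof.
move=> a0 adec.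
have ac : cvgn a.
  apply: nonincreasing_is_cvgn; first by apply/nonincreasing_seqP.
  by exists 0 => _ [k _ <-].
rewrite -(subrr (limn a)); apply: cvgB => //.
by move: ac; rewrite -(cvg_shiftS a).
Qed.

(** The constant valid from [N] on is enlarged at the earlier indices one at a time. A bound at each
    single index is part of the data because [b i] may vanish. *)
Lemma eventually_bounded_ratio (a b : nat -> R) : (forall i, 0 <= b i) ->
  (forall i, exists c, a i <= c * b i) ->
  (exists N c, forall i, (N <= i)%N -> a i <= c * b i) ->
  exists c, forall i, a i <= c * b i.
Proof.
move=> b0 abi [N [c]]; elim: N c => [|N IH] c abN; first by exists c => i; exact: abN.
have [d abd] := abi N; apply: (IH (Num.max c d)) => i.
rewrite leq_eqVlt => /predU1P[<-|Ni].
  by rewrite (le_trans abd)// ler_wpM2r// le_max lexx orbT.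
by rewrite (le_trans (abN _ Ni))// ler_wpM2r// le_max lexx.
Qed.

Lemma contraction_cvg0 (r : R) (a e : nat -> R) :
  0 <= r < 1 -> (forall k, 0 <= a k) -> (forall k, a k.+1 <= r * a k + e k) ->
  e @ \oo --> (0 : R) -> a @ \oo --> (0 : R).
Proof.
move=> /andP[r0 r1] a0 ae e0.
apply/cvgrPdist_le => d d0.
have r1' : 0 < 1 - r by rewrite subr_gt0.
(* [d / 2] is the fixed point of [a -> r * a + d / 2 * (1 - r)], so errors below this threshold
   contribute at most [d / 2] in total. *)
have /cvgrPdist_le/(_ (d / 2 * (1 - r))) := e0.
case; first by rewrite mulr_gt0// divr_gt0.
move=> N _ eN.
have aN k : a (N + k)%N <= r ^+ k * a N + d / 2.
  elim: k => [|k IH]; first by rewrite addn0 expr0 mul1r lerDl ltW// divr_gt0.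
  have := eN (N + k)%N (leq_addr _ _); rewrite /= sub0r normrN => ek.
  rewrite addnS (le_trans (ae _))//.
  have /le_trans -> // : r * a (N + k)%N + e (N + k)%N <=
      r * (r ^+ k * a N + d / 2) + d / 2 * (1 - r).
    by rewrite lerD ?ler_wpM2l// (le_trans (ler_norm _)).
  by rewrite exprS; lra.
have : (fun k => r ^+ k * a N) @ \oo --> (0 : R).
  rewrite -(mul0r (a N)); apply: cvgM; last exact: cvg_cst.
  by apply: cvg_expr; rewrite ger0_norm.
move/cvgrPdist_le => /(_ (d / 2)); case; first by rewrite divr_gt0.
move=> N' _ rN.
exists (N + N')%N => // k /= Nk.
rewrite sub0r normrN ger0_norm//.
have -> : k = (N + (k - N))%N by rewrite subnKC// (leq_trans (leq_addr _ _) Nk).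
apply: (le_trans (aN _)).
have /rN : (N' <= k - N)%N by rewrite leq_subRL// (leq_trans (leq_addr _ _) Nk).
rewrite /= sub0r normrN => /(le_trans (ler_norm _)) rk.
lra.
Qed.
End MatrixLimits.

(** * Quadratic forms *)

Definition bilform (R : realType) (a b : nat) (M : 'M[R]_(a, b))
    (u : 'cV[R]_a) (v : 'cV[R]_b) : R := (u^T *m M *m v) ord0 ord0.

Definition psdmx (R : realType) (a : nat) (M : 'M[R]_a) : Prop :=
  forall v, 0 <= quadform M v.

Section QuadraticForms.
Variable R : realType.

Lemma bilformDl (a b : nat) (M : 'M[R]_(a, b)) u u' v :
  bilform M (u + u') v = bilform M u v + bilform M u' v.
Proof. by rewrite /bilform linearD/= !mulmxDl mxE. Qed.

Lemma bilformDr (a b : nat) (M : 'M[R]_(a, b)) u v v' :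
  bilform M u (v + v') = bilform M u v + bilform M u v'.
Proof. by rewrite /bilform mulmxDr mxE. Qed.

Lemma bilformZl (a b : nat) (M : 'M[R]_(a, b)) c u v :
  bilform M (c *: u) v = c * bilform M u v.
Proof. by rewrite /bilform linearZ/= -!scalemxAl mxE. Qed.

Lemma bilformZr (a b : nat) (M : 'M[R]_(a, b)) c u v :
  bilform M u (c *: v) = c * bilform M u v.
Proof. by rewrite /bilform -scalemxAr mxE. Qed.

Lemma bilform_trmx (a b : nat) (M : 'M[R]_(a, b)) u v :
  bilform M^T v u = bilform M u v.
Proof.
rewrite /bilform; transitivity ((v^T *m M^T *m u)^T ord0 ord0).
  by rewrite [RHS]mxE.
by rewrite !trmx_mul !trmxK mulmxA.
Qed.

Lemma bilform_mulr (a b c : nat) (M : 'M[R]_(a, b)) (N : 'M[R]_(b, c)) u v :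
  bilform M u (N *m v) = bilform (M *m N) u v.
Proof. by rewrite /bilform !mulmxA. Qed.

Lemma bilform_mull (a b c : nat) (M : 'M[R]_(a, b)) (N : 'M[R]_(a, c)) u v :
  bilform M (N *m u) v = bilform (N^T *m M) u v.
Proof. by rewrite /bilform trmx_mul !mulmxA. Qed.

Lemma bilform_delta (a b : nat) (M : 'M[R]_(a, b)) i j :
  bilform M (delta_mx i 0) (delta_mx j 0) = M i j.
Proof. by rewrite /bilform trmx_delta -rowE -colE !mxE. Qed.

Lemma quadform_mul (a b : nat) (M : 'M[R]_a) (N : 'M[R]_(a, b)) v :
  quadform M (N *m v) = quadform (N^T *m M *m N) v.
Proof. by rewrite -[LHS]/(bilform _ _ _) bilform_mulr bilform_mull mulmxA. Qed.

Lemma quadformD (a : nat) (M : 'M[R]_a) u v : M^T = M ->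
  quadform M (u + v) = quadform M u + quadform M v + 2 * bilform M u v.
Proof.
move=> Ms; rewrite -[LHS]/(bilform _ _ _) bilformDl !bilformDr.
by rewrite -[in X in _ + (X + _)]Ms bilform_trmx /quadform /bilform; ring.
Qed.

Lemma quadformZ (a : nat) (M : 'M[R]_a) c v :
  quadform M (c *: v) = c ^+ 2 * quadform M v.
Proof. by rewrite -[LHS]/(bilform _ _ _) bilformZl bilformZr mulrA expr2. Qed.

Lemma quadformN (a : nat) (M : 'M[R]_a) v : quadform M (- v) = quadform M v.
Proof. by rewrite -scaleN1r quadformZ sqrrN expr1n mul1r. Qed.

Lemma quadform0 (a : nat) (M : 'M[R]_a) : quadform M 0 = 0.
Proof. by rewrite /quadform mulmx0 mxE. Qed.

Lemma quadform_addmx (a : nat) (M N : 'M[R]_a) v :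
  quadform (M + N) v = quadform M v + quadform N v.
Proof. by rewrite /quadform mulmxDr mulmxDl mxE. Qed.

Lemma quadform_oppmx (a : nat) (M : 'M[R]_a) v :
  quadform (- M) v = - quadform M v.
Proof. by rewrite /quadform mulmxN mulNmx mxE. Qed.

Lemma quadform_submx (a : nat) (M N : 'M[R]_a) v :
  quadform (M - N) v = quadform M v - quadform N v.
Proof. by rewrite quadform_addmx quadform_oppmx. Qed.

Lemma quadform_scalemx (a : nat) (c : R) (M : 'M[R]_a) v :
  quadform (c *: M) v = c * quadform M v.
Proof. by rewrite /quadform -scalemxAr -scalemxAl mxE. Qed.

Lemma quadform_delta (a : nat) (M : 'M[R]_a) i :
  quadform M (delta_mx i 0) = M i i.
Proof. exact: bilform_delta. Qed.

Lemma quadform1 (a : nat) (v : 'cV[R]_a) :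
  quadform 1%:M v = \sum_i v i 0 ^+ 2.
Proof. by rewrite /quadform mulmx1 trmx_mul_self. Qed.

Lemma polarization (a : nat) (M : 'M[R]_a) i j : M^T = M ->
  M i j = (quadform M (delta_mx i 0 + delta_mx j 0) -
    quadform M (delta_mx i 0) - quadform M (delta_mx j 0)) / 2.
Proof. by move=> Ms; rewrite quadformD// bilform_delta; field. Qed.

Lemma quadform_inj (a : nat) (M N : 'M[R]_a) : M^T = M -> N^T = N ->
  (forall v, quadform M v = quadform N v) -> M = N.
Proof.
by move=> Ms Ns MN; apply/matrixP => i j; rewrite !polarization// !MN.
Qed.

Lemma cvg_quadform (a : nat) (M : nat -> 'M[R]_a) (v : nat -> 'cV[R]_a) L w :
  M @ \oo --> L -> v @ \oo --> w ->
  (fun k => quadform (M k) (v k)) @ \oo --> quadform L w.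
Proof.
move=> ML vw; have := cvg_mulmx (cvg_mulmx (cvg_trmx vw) ML) vw.
by move/cvg_mxP; exact.
Qed.

Lemma psd_limit (a : nat) (M : nat -> 'M[R]_a) (L : 'M[R]_a) :
  M @ \oo --> L -> (forall k, psdmx (M k)) -> psdmx L.
Proof.
move=> ML M0 v.
have Mv : (fun k => quadform (M k) v) @ \oo --> quadform L v.
  by apply: cvg_quadform => //; exact: cvg_cst.
rewrite -(cvg_lim _ Mv)//; apply: limr_ge; first exact: cvgP Mv.
by near=> k; exact: M0.
Unshelve. all: by end_near.
Qed.

Lemma norm_trmx (a b : nat) (M : 'M[R]_(a, b)) : `|M^T| = `|M|.
Proof.
apply/eqP; rewrite eq_le; apply/andP; split; apply: mx_norm_le => // i j.
  by rewrite mxE entry_le_norm.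
by have -> : M i j = M^T j i by [rewrite mxE]; exact: entry_le_norm.
Qed.

Lemma quadform_norm_le (a : nat) (M : 'M[R]_a) v :
  `|quadform M v| <= a%:R ^+ 2 * `|M| * `|v| ^+ 2.
Proof.
rewrite (le_trans (entry_le_norm _ _ _))// (le_trans (mulmx_norm_le _ _))//.
have -> : a%:R ^+ 2 * `|M| * `|v| ^+ 2 =
    a%:R * (a%:R * (`|v^T| * `|M|) * `|v|) by rewrite norm_trmx; ring.
by rewrite ler_wpM2l// ler_wpM2r// mulmx_norm_le.
Qed.

Lemma norm_sqr_le (a : nat) (v : 'cV[R]_a) : `|v| ^+ 2 <= quadform 1%:M v.
Proof.
have s0 : 0 <= quadform 1%:M v.
  by rewrite quadform1 sumr_ge0// => i _; exact: sqr_ge0.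
rewrite -(sqr_sqrtr s0) ler_sqr ?nnegrE ?sqrtr_ge0//.
apply: mx_norm_le; first exact: sqrtr_ge0.
move=> i j; rewrite ord1 -sqrtr_sqr ler_wsqrtr// quadform1.
by rewrite (bigD1 i)//= lerDl sumr_ge0// => k _; exact: sqr_ge0.
Qed.

Lemma psd_entry_le (a : nat) (M : 'M[R]_a) i j : M^T = M -> psdmx M ->
  `|M i j| <= (M i i + M j j) / 2.
Proof.
move=> Ms M0.
have := M0 (delta_mx i 0 + delta_mx j 0).
have := M0 (delta_mx i 0 - delta_mx j 0).
rewrite !quadformD// quadformN -scaleN1r bilformZr bilform_delta !quadform_delta.
by move=> h1 h2; rewrite ler_norml; apply/andP; split; lra.
Qed.

Lemma psd_norm_le_tr (a : nat) (M : 'M[R]_a) : M^T = M -> psdmx M ->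
  `|M| <= \tr M.
Proof.
move=> Ms M0.
have d0 i : 0 <= M i i by rewrite -quadform_delta.
have dt i : M i i <= \tr M.
  by rewrite /mxtrace (bigD1 i)//= lerDl sumr_ge0.
apply: mx_norm_le; first by rewrite sumr_ge0.
move=> i j; rewrite (le_trans (psd_entry_le i j Ms M0))//.
have := dt i; have := dt j; lra.
Qed.

Lemma posdef_psd (a : nat) (M : 'M[R]_a) : posdefmx M -> psdmx M.
Proof.
by move=> M0 v; have [->|/M0/ltW//] := eqVneq v 0; rewrite quadform0.
Qed.

Lemma posdef_unit (a : nat) (M : 'M[R]_a) : posdefmx M -> M \in unitmx.
Proof.
move=> M0; rewrite -unitmx_tr -row_free_unit -kermx_eq0; apply/eqP/row_matrixP => i.
rewrite row0; set v := row i _.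
have vM : v *m M^T = 0 by rewrite /v -row_mul mulmx_ker row0.
apply/eqP; apply: contraT => v0.
have /M0 : v^T != 0 by rewrite trmx_eq0.
by rewrite /quadform -mulmxA -[M *m _]trmxK trmx_mul trmxK vM trmx0 mulmx0 mxE ltxx.
Qed.

Lemma cauchy_schwarz (a : nat) (M : 'M[R]_a) u v : M^T = M -> posdefmx M ->
  bilform M u v ^+ 2 <= quadform M u * quadform M v.
Proof.
move=> Ms M0; have [->|/M0 v0] := eqVneq v 0.
  by rewrite quadform0 -(scale0r 0) bilformZr mul0r mulr0 expr0n.
(* This multiple of the component of [u] orthogonal to [v] has form [y * (x * y - b ^+ 2)], where
   [y > 0]. *)
have := posdef_psd M0 (quadform M v *: u - bilform M u v *: v).
rewrite quadformD// -scaleNr !quadformZ bilformZl bilformZr.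
set b := bilform _ _ _; set x := quadform M u; set y := quadform M v in v0 *.
have -> : y ^+ 2 * x + (- b) ^+ 2 * y + 2 * (y * (- b * b)) = y * (x * y - b ^+ 2).
  by ring.
by rewrite pmulr_rge0// subr_ge0.
Qed.

(* Cauchy-Schwarz for the form of [M], applied to [M^-1 e_i] and [v], bounds
   the [i]-th entry of [v]. *)
Lemma posdef_coercive (a : nat) (M : 'M[R]_a) : M^T = M -> posdefmx M ->
  exists2 c : R, 0 <= c & forall v, `|v| ^+ 2 <= c * quadform M v.
Proof.
move=> Ms M0; pose w i : 'cV_a := invmx M *m delta_mx i 0.
have w0 i : 0 <= quadform M (w i) := posdef_psd M0 (w i).
exists (\sum_i quadform M (w i)); first by rewrite sumr_ge0.
move=> v; have v0 := posdef_psd M0 v.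
have s0 : 0 <= \sum_i quadform M (w i) * quadform M v.
  by rewrite sumr_ge0// => i _; rewrite mulr_ge0.
rewrite mulr_suml -(sqr_sqrtr s0) ler_sqr ?nnegrE ?sqrtr_ge0//.
apply: mx_norm_le; first exact: sqrtr_ge0.
move=> i j; rewrite ord1 -sqrtr_sqr ler_wsqrtr//.
have -> : v i 0 = bilform M (w i) v.
  rewrite /w bilform_mull trmx_inv Ms mulVmx ?posdef_unit//.
  by rewrite /bilform mulmx1 trmx_delta -rowE mxE.
rewrite (le_trans (cauchy_schwarz _ _ Ms M0))//.
by rewrite (bigD1 i)//= lerDl sumr_ge0// => k _; rewrite mulr_ge0.
Qed.

(** Each real sequence [quadform (M k) v] is monotone and bounded, and polarization recovers the
    entries from such values. *)
Lemma quadform_mono_cvg (a : nat) (M : nat -> 'M[R]_a) :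
  (forall k, (M k)^T = M k) ->
  (forall v k, quadform (M k) v <= quadform (M k.+1) v) ->
  (forall v, exists c, forall k, quadform (M k) v <= c) ->
  exists2 L : 'M[R]_a, L^T = L & M @ \oo --> L.
Proof.
move=> Ms Mnd Mub.
have Mcvg v : cvgn (fun k => quadform (M k) v).
  apply: nondecreasing_is_cvgn; first exact/nondecreasing_seqP.
  by have [c Mc] := Mub v; exists c => _ [k _ <-].
have Mij i j : cvgn (fun k => M k i j).
  rewrite (funext (fun k => polarization i j (Ms k))).
  apply: is_cvgM; last exact: is_cvg_cst.
  by apply: is_cvgB => //; apply: is_cvgB.
exists (\matrix_(i, j) limn (fun k => M k i j)).
  apply/matrixP => i j; rewrite !mxE.
  suff -> : (fun k => M k j i) = (fun k => M k i j) by [].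
  by apply/funext => k; rewrite -[in LHS]Ms mxE.
by apply/cvg_mxP => i j; rewrite mxE; exact: Mij.
Qed.

(** For each column, [|w|^2 <= c M(w) <= c S(w) = c w^T g]. The constant is common to all [S] above
    [M]; with [S] a Hessian above [Ru], it makes gains Lipschitz uniformly in the cost matrix. *)
Lemma posdef_ge_solve (a b : nat) (M : 'M[R]_a) : M^T = M -> posdefmx M ->
  exists2 c : R, 0 <= c & forall (S : 'M[R]_a) (W G : 'M[R]_(a, b)),
    (forall v, quadform M v <= quadform S v) -> S *m W = G -> `|W| <= c * `|G|.
Proof.
move=> Ms M0; have [c c0 cM] := posdef_coercive Ms M0.
exists (c * a%:R); first by rewrite mulr_ge0.
move=> S W G MS SW; apply: mx_norm_le; first by rewrite !mulr_ge0.
move=> i j; apply: (@le_trans _ _ `|col j W|).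
  by have -> : W i j = col j W i 0 by [rewrite mxE]; exact: entry_le_norm.
set w := col j W; set g := col j G.
have Sw : S *m w = g by rewrite /w /g -SW !colE mulmxA.
have gG : `|g| <= `|G|.
  by apply: mx_norm_le => // k k'; rewrite mxE entry_le_norm.
have wg : quadform S w <= a%:R * (`|w| * `|g|).
  rewrite /quadform -mulmxA Sw (le_trans (ler_norm _))//.
  by rewrite (le_trans (entry_le_norm _ _ _))// -(norm_trmx w) mulmx_norm_le.
have := cM w.
have [->|w0 cw] := eqVneq w 0; first by rewrite normr0 !mulr_ge0.
have nw : 0 < `|w| by rewrite normr_gt0.
rewrite -(ler_pM2r nw) -expr2 (le_trans cw)// (le_trans (ler_wpM2l c0 (MS w)))//.
rewrite (le_trans (ler_wpM2l c0 wg))//.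
have -> : c * a%:R * `|G| * `|w| = c * (a%:R * (`|w| * `|G|)) by ring.
by do 3! apply: ler_wpM2l => //.
Qed.
End QuadraticForms.

(** * Stein equations and the linear-quadratic regulator *)

(** Stability is expressed through orbits, the form in which it is used; eigenvalues enter only
    through [schur_stable]. *)
Definition stable (R : realType) (q : nat) (F : 'M[R]_q) : Prop :=
  forall z : nat -> 'cV[R]_q,
    (forall t, z t.+1 = F *m z t) -> z @ \oo --> (0 : 'cV[R]_q).

Section Stein.
Variables (R : realType) (q : nat).
Implicit Types F D W : 'M[R]_q.

Lemma stable_orbit F v : stable F ->
  (fun t => iter t (mulmx F) v) @ \oo --> (0 : 'cV[R]_q).
Proof. by apply. Qed.

(** The values of the form along an orbit decrease to [0], so the first one is nonnegative. All
    later comparisons of cost matrices rest on this. *)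
Lemma stable_decrease_psd F D : stable F ->
  (forall v, quadform D (F *m v) <= quadform D v) -> psdmx D.
Proof.
move=> Fst Ddec v.
have /(cvg_quadform (cvg_cst D)) := stable_orbit v Fst; rewrite quadform0 => Dc.
have /nonincreasing_seqP Dn : forall t,
    quadform D (iter t.+1 (mulmx F) v) <= quadform D (iter t (mulmx F) v).
  by move=> t; exact: Ddec.
have := nonincreasing_cvgn_ge Dn (cvgP _ Dc) 0%N.
by rewrite (cvg_lim _ Dc).
Qed.

(** The bilinear form of [D] is constant along a pair of orbits of [F], while the orbits tend to
    [0]. *)
Lemma stein_inj F D : stable F -> D = F^T *m D *m F -> D = 0.
Proof.
move=> Fst DF.
have Dt t u v : bilform D (iter t (mulmx F) u) (iter t (mulmx F) v) = bilform D u v.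
  by elim: t => //= t IH; rewrite bilform_mull bilform_mulr -DF.
apply/matrixP => i j; rewrite mxE -bilform_delta.
set u := delta_mx i 0; set v := delta_mx j 0.
have : (fun t => bilform D (iter t (mulmx F) u) (iter t (mulmx F) v)) @ \oo --> (0 : R).
  have Fu : (fun t => (iter t (mulmx F) u)^T *m D) @ \oo --> 0^T *m D.
    by apply: cvg_mulmx; [exact: cvg_trmx (stable_orbit u Fst)|exact: cvg_cst].
  have /cvg_mxP/(_ 0 0) := cvg_mulmx Fu (stable_orbit v Fst).
  by rewrite trmx0 !mul0mx mxE.
under eq_fun do rewrite Dt.
by move=> h; apply: (cvg_unique _ (cvg_cst _) h).
Qed.

(** The map [D - F^T D F] is an injective endomorphism of a finite-dimensional space, hence onto. *)
Lemma stein_solvable F W : stable F -> exists D, D = W + F^T *m D *m F.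
Proof.
move=> Fst.
pose g : 'End('M[R]_q) := (\1 - linfun (mulmx F^T \o mulmxr F))%VF.
have gE D : g D = D - F^T *m (D *m F).
  by rewrite /g add_lfunE opp_lfunE id_lfunE lfunE.
have g0 : lker g == 0%VS.
  apply/lker0P => D D' /eqP; rewrite -subr_eq0 -linearB/= gE subr_eq0 => /eqP DD.
  by apply/eqP; rewrite -subr_eq0; apply/eqP/(stein_inj Fst); rewrite -mulmxA.
exists (g^-1%VF W); rewrite -{2}(lker0_lfunVK g0 W) gE mulmxA subrK//.
Qed.

Lemma stein_sym F W D : stable F -> W^T = W -> D = W + F^T *m D *m F -> D^T = D.
Proof.
move=> Fst Ws DF; apply/eqP; rewrite -subr_eq0; apply/eqP/(stein_inj Fst).
rewrite mulmxBr mulmxBl [in LHS]DF linearD/= Ws !trmx_mul trmxK mulmxA.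
by rewrite opprD addrACA subrr add0r.
Qed.
End Stein.

(** * Optimal gains, completion of squares and Lyapunov equations *)

Section LinearQuadraticRegulator.
Variables (R : realType) (q m p : nat).
Variables (A : 'M[R]_q) (B : 'M[R]_(q, m)) (C : 'M[R]_(p, q)).
Variables (Q : 'M[R]_p) (Ru : 'M[R]_m).
Hypotheses (Qsym : Q^T = Q) (Qpos : posdefmx Q).
Hypotheses (Rusym : Ru^T = Ru) (Rupos : posdefmx Ru).
Implicit Types (P : 'M[R]_q) (K : 'M[R]_(m, q)).

Definition lin_dyn (z : nat -> 'cV[R]_q) (u : nat -> 'cV[R]_m) : Prop :=
  forall t, z t.+1 = A *m z t + B *m u t.

Definition cl_mx K : 'M[R]_q := A - B *m K.

Definition stage_cost (z : 'cV[R]_q) (u : 'cV[R]_m) : R :=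
  quadform Q (C *m z) + quadform Ru u.

(** The matrix of the part quadratic in [u] of [stage_cost z u + quadform P (A z + B u)]. *)
Definition hess P : 'M[R]_m := Ru + B^T *m P *m B.

(** For symmetric [P], stationarity of that function of [u] at [u = - K z]. *)
Definition is_gain P K : Prop := hess P *m K = B^T *m P *m A.

Definition gain P : 'M[R]_(m, q) := invmx (hess P) *m (B^T *m P *m A).

Definition lyap K P : Prop := forall z,
  quadform P z = stage_cost z (K *m z) + quadform P (cl_mx K *m z).

Hypothesis zero_detectable : forall z u, lin_dyn z u ->
  (fun t => C *m z t) @ \oo --> (0 : 'cV[R]_p) -> u @ \oo --> (0 : 'cV[R]_m) ->
  z @ \oo --> (0 : 'cV[R]_q).
(** The approach to [0] is asymptotic and without rate, and no bound on [u] is asked, so the cost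
    along such a trajectory may be infinite. *)
Hypothesis null_controllable : forall z0, exists z u,
  [/\ z 0%N = z0, lin_dyn z u & z @ \oo --> (0 : 'cV[R]_q)].

Lemma stage_cost_ge0 z u : 0 <= stage_cost z u.
Proof. by rewrite addr_ge0// posdef_psd. Qed.

Lemma stage_costN z u : stage_cost z (- u) = stage_cost z u.
Proof. by rewrite /stage_cost quadformN. Qed.

Lemma quadform_hess P g :
  quadform (hess P) g = quadform Ru g + quadform P (B *m g).
Proof. by rewrite quadform_addmx quadform_mul. Qed.

Lemma hess_ge P g : psdmx P -> quadform Ru g <= quadform (hess P) g.
Proof. by move=> P0; rewrite quadform_hess lerDl. Qed.

Lemma hess_psd P : psdmx P -> psdmx (hess P).
Proof. by move=> P0 g; rewrite (le_trans _ (hess_ge g P0))// posdef_psd. Qed.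

Lemma hess_posdef P : psdmx P -> posdefmx (hess P).
Proof. by move=> P0 g g0; rewrite (lt_le_trans _ (hess_ge g P0))// Rupos. Qed.

Lemma gainP P : psdmx P -> is_gain P (gain P).
Proof.
move=> P0; rewrite /is_gain /gain mulmxA mulmxV ?mul1mx//.
exact/posdef_unit/hess_posdef.
Qed.

Lemma is_gain_closed P K : is_gain P K -> Ru *m K = B^T *m P *m cl_mx K.
Proof.
by move=> PK; rewrite /cl_mx mulmxBr -PK /hess mulmxDl !mulmxA addrK.
Qed.

(** The gain error solves a linear system whose right-hand side is linear in [P - P']; only the
    closed loop of the reference gain [K'] appears in it. *)
Lemma is_gain_sub P K P' K' : is_gain P K -> is_gain P' K' ->
  hess P *m (K - K') = B^T *m (P - P') *m cl_mx K'.
Proof.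
move=> PK PK'; rewrite mulmxBr PK (mulmxBr B^T) mulmxBl -(is_gain_closed PK').
rewrite /cl_mx mulmxBr /hess mulmxDl !mulmxA.
by rewrite opprD addrA addrAC.
Qed.

(** With [u = g - K z], the terms bilinear in [g] and [z] cancel by [is_gain_closed]; what remains
    in [g] is the form of [hess P]. *)
Lemma complete_square P K z u : P^T = P -> is_gain P K ->
  stage_cost z u + quadform P (A *m z + B *m u) =
  stage_cost z (K *m z) + quadform P (cl_mx K *m z) +
  quadform (hess P) (u + K *m z).
Proof.
move=> Ps PK; rewrite -[u](addrK (K *m z)).
move: (u + K *m z) => g; rewrite subrK.
have -> : A *m z + B *m (g - K *m z) = cl_mx K *m z + B *m g.
  by rewrite mulmxBr /cl_mx mulmxBl mulmxA addrCA addrC.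
rewrite /stage_cost !quadformD// quadformN quadform_hess.
have -> : bilform P (cl_mx K *m z) (B *m g) = bilform Ru g (K *m z).
  rewrite -bilform_trmx Ps bilform_mull !bilform_mulr.
  by rewrite (is_gain_closed PK).
by rewrite -[- (K *m z)]scaleN1r bilformZr; ring.
Qed.

Lemma complete_square_gain P K K' z : P^T = P -> is_gain P K ->
  stage_cost z (K' *m z) + quadform P (cl_mx K' *m z) =
  stage_cost z (K *m z) + quadform P (cl_mx K *m z) +
  quadform (hess P) ((K' - K) *m z).
Proof.
move=> Ps PK; rewrite -stage_costN.
have -> : cl_mx K' *m z = A *m z + B *m (- (K' *m z)).
  by rewrite /cl_mx mulmxBl mulmxN mulmxA.
rewrite (complete_square _ _ Ps PK); congr (_ + _).
by rewrite -quadformN opprD opprK mulmxBl.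
Qed.

Lemma lin_dyn_feedback K z :
  (forall t, z t.+1 = cl_mx K *m z t) -> lin_dyn z (fun t => - (K *m z t)).
Proof. by move=> zK t; rewrite zK /cl_mx mulmxBl mulmxN mulmxA. Qed.

(** [P] is only semidefinite, so it does not control [z] directly. The stage costs are bounded by
    the decrements of [P] and tend to [0]; coercivity of [Q] and [Ru] gives decay of output and
    input, and detectability gives decay of the state. *)
Lemma decrease_stable K P : psdmx P ->
  (forall z, stage_cost z (K *m z) + quadform P (cl_mx K *m z) <= quadform P z) ->
  stable (cl_mx K).
Proof.
move=> P0 Pdec z zK.
have s0 : (fun t => stage_cost (z t) (K *m z t)) @ \oo --> (0 : R).
  have Pt0 t : 0 <= quadform P (z t) by [].
  have Ptd t : quadform P (z t.+1) <= quadform P (z t).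
    rewrite zK; apply: le_trans (Pdec _); rewrite lerDr; exact: stage_cost_ge0.
  apply: squeeze_cvg0 (nonincreasing_diff_cvg0 Pt0 Ptd) => t.
  by rewrite stage_cost_ge0/= zK lerBrDr.
have cvg_of_form (a : nat) (M : 'M[R]_a) (v : nat -> 'cV[R]_a) :
    M^T = M -> posdefmx M ->
    (forall t, quadform M (v t) <= stage_cost (z t) (K *m z t)) ->
    v @ \oo --> (0 : 'cV[R]_a).
  move=> Ms M0 vs; have [c c0 cM] := posdef_coercive Ms M0.
  apply: sqr_norm_cvg0.
  apply: (@squeeze_cvg0 _ _ (fun t => c * stage_cost (z t) (K *m z t))).
    by move=> t; rewrite sqr_ge0/= (le_trans (cM _))// ler_wpM2l.
  by rewrite -(mulr0 c); apply: cvgM => //; exact: cvg_cst.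
apply: (zero_detectable (lin_dyn_feedback zK)).
  by apply: (cvg_of_form _ Q) => // t; rewrite lerDl posdef_psd.
rewrite -oppr0; apply: cvgN.
by apply: (cvg_of_form _ Ru) => // t; rewrite lerDr posdef_psd.
Qed.

Lemma lyap_psd K P : stable (cl_mx K) -> lyap K P -> psdmx P.
Proof.
move=> Kst KP; apply: (stable_decrease_psd Kst) => z.
by rewrite [leRHS]KP lerDr stage_cost_ge0.
Qed.

Lemma lyap_stable K P : psdmx P -> lyap K P -> stable (cl_mx K).
Proof. by move=> P0 KP; apply: (decrease_stable P0) => z; rewrite -KP. Qed.

Lemma lyapE K P : P = C^T *m Q *m C + K^T *m Ru *m K +
  (cl_mx K)^T *m P *m cl_mx K -> lyap K P.
Proof.
by move=> PE z; rewrite {1}PE !quadform_addmx -!quadform_mul.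
Qed.

Lemma stage_mx_sym K :
  (C^T *m Q *m C + K^T *m Ru *m K)^T = C^T *m Q *m C + K^T *m Ru *m K.
Proof. by rewrite linearD/= !trmx_mul !trmxK Qsym Rusym !mulmxA. Qed.

(** * Value iteration and the Riccati equation *)

Definition riccati P : 'M[R]_q := let K := gain P in
  C^T *m Q *m C + K^T *m Ru *m K + (cl_mx K)^T *m P *m cl_mx K.

Fixpoint value_iter k : 'M[R]_q :=
  if k is k'.+1 then riccati (value_iter k') else 0.

Lemma value_iterS k z : quadform (value_iter k.+1) z =
  stage_cost z (gain (value_iter k) *m z) +
  quadform (value_iter k) (cl_mx (gain (value_iter k)) *m z).
Proof. by rewrite /= !quadform_addmx -!quadform_mul. Qed.

Lemma value_iter_sym k : (value_iter k)^T = value_iter k.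
Proof.
elim: k => [|k IH] /=; first by rewrite trmx0.
rewrite /riccati; move: (gain _) => K; rewrite linearD/= stage_mx_sym.
by move: (cl_mx K) => F; rewrite !trmx_mul trmxK IH !mulmxA.
Qed.

Lemma value_iter_psd k : psdmx (value_iter k).
Proof.
elim: k => [|k IH] z; first by rewrite /quadform mulmx0 mul0mx mxE.
by rewrite value_iterS addr_ge0// stage_cost_ge0.
Qed.

(** The excess of any input over the greedy one is a value of the nonnegative form [hess]. *)
Lemma value_iter_opt k z u : quadform (value_iter k.+1) z <=
  stage_cost z u + quadform (value_iter k) (A *m z + B *m u).
Proof.
rewrite (complete_square _ _ (value_iter_sym k) (gainP (value_iter_psd k))).
by rewrite value_iterS lerDl (hess_psd (value_iter_psd k)).
Qed.

(** The gain that is greedy for the later iterate is a competitor in the Bellman inequality of the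
    earlier one. *)
Lemma value_iter_nd k z :
  quadform (value_iter k) z <= quadform (value_iter k.+1) z.
Proof.
elim: k z => [|k IH] z.
  rewrite (_ : quadform (value_iter 0) z = 0) ?value_iter_psd//.
  by rewrite /quadform mulmx0 mul0mx mxE.
rewrite [leRHS]value_iterS; move: (gain _) => K.
have -> : stage_cost z (K *m z) = stage_cost z (- (K *m z)) by rewrite stage_costN.
have -> : cl_mx K *m z = A *m z + B *m (- (K *m z)).
  by rewrite /cl_mx mulmxBl mulmxN mulmxA.
by rewrite (le_trans (value_iter_opt k _ (- (K *m z))))// lerD2l.
Qed.

Lemma value_iter_homo k l z : (k <= l)%N ->
  quadform (value_iter k) z <= quadform (value_iter l) z.
Proof.
move=> /subnK <-; elim: (l - k)%N => // j IH.
by rewrite addSn (le_trans IH)// value_iter_nd.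
Qed.

Lemma value_iter_dp N k z u : lin_dyn z u ->
  quadform (value_iter (N + k)) (z 0%N) <=
  \sum_(t < N) stage_cost (z t) (u t) + quadform (value_iter k) (z N).
Proof.
elim: N z u => [|N IH] z u zu; first by rewrite big_ord0 add0r.
rewrite big_ord_recl -addrA addSn.
apply: (le_trans (value_iter_opt _ _ (u 0%N))).
by rewrite lerD2l -zu; apply: (IH (fun t => z t.+1) (fun t => u t.+1)) => t.
Qed.

(* Along inputs driving each basis vector close to [0] at a common time [N],
   dynamic programming gives [tr P_(N+k) <= c + tr P_k / 2]; since the traces
   are nondecreasing, they are bounded by [2 c]. *)
Lemma value_iter_tr_bounded : exists c, forall k, \tr (value_iter k) <= c.
Proof.
have /choice[Z ZP] : forall i : 'I_q, exists zu : (nat -> 'cV[R]_q) * (nat -> 'cV[R]_m),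
    [/\ zu.1 0%N = delta_mx i 0, lin_dyn zu.1 zu.2
      & zu.1 @ \oo --> (0 : 'cV[R]_q)].
  move=> i; have [z [u [z0 zu zc]]] := null_controllable (delta_mx i 0).
  by exists (z, u).
have : (fun t => \sum_i q%:R ^+ 2 * `|(Z i).1 t| ^+ 2) @ \oo --> (0 : R).
  rewrite [X in _ --> X](_ : 0 = \sum_(i < q) q%:R ^+ 2 * `|0 : 'cV[R]_q| ^+ 2); last first.
    by rewrite big1// => i _; rewrite normr0 expr0n mulr0.
  apply: cvg_sum => i; apply: cvgM; first exact: cvg_cst.
  rewrite expr2; under eq_fun do rewrite expr2.
  by have [_ _ zc] := ZP i; apply: cvgM; exact: cvg_norm.
move/cvgrPdist_le => /(_ (1/2)); case; first by rewrite divr_gt0.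
move=> N _ /(_ N (leqnn N)); rewrite /= sub0r normrN => /(le_trans (ler_norm _)) sN.
set c := \sum_i \sum_(t < N) stage_cost ((Z i).1 t) ((Z i).2 t).
exists (2 * c) => k.
have trE j : \tr (value_iter j) = \sum_i quadform (value_iter j) ((Z i).1 0%N).
  by apply: eq_bigr => i _; have [-> _ _] := ZP i; rewrite quadform_delta.
have tr0 : 0 <= \tr (value_iter k).
  by rewrite trE sumr_ge0// => i _; exact: value_iter_psd.
have h1 : \tr (value_iter k) <= \tr (value_iter (N + k)).
  by rewrite !trE ler_sum// => i _; rewrite value_iter_homo// leq_addl.
have h2 : \tr (value_iter (N + k)) <= c + \sum_i quadform (value_iter k) ((Z i).1 N).
  rewrite trE /c -big_split/= ler_sum// => i _.
  by have [_ zu _] := ZP i; exact: value_iter_dp.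
have h3 : \sum_i quadform (value_iter k) ((Z i).1 N) <= 1 / 2 * \tr (value_iter k).
  rewrite (le_trans _ (ler_wpM2r tr0 sN))// mulr_suml ler_sum// => i _.
  rewrite (le_trans (ler_norm _))// (le_trans (quadform_norm_le _ _))//.
  rewrite mulrAC ler_wpM2l ?mulr_ge0//.
  exact: psd_norm_le_tr (value_iter_sym k) (value_iter_psd k).
lra.
Qed.

(** Combines [is_gain_sub] with the lower bound [Ru] on every Hessian; the constant depends on the
    reference gain [K'] but on neither [P] nor [K]. *)
Lemma gain_dist (K' : 'M[R]_(m, q)) : exists2 c : R, 0 <= c & forall P K P',
  psdmx P -> is_gain P K -> is_gain P' K' -> `|K - K'| <= c * `|P - P'|.
Proof.
have [c c0 cR] := posdef_ge_solve q Rusym Rupos.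
exists (c * (q%:R * (q%:R * `|B^T| * `|cl_mx K'|))).
  by rewrite !mulr_ge0.
move=> P K P' P0 PK PK'.
apply: (le_trans (cR _ _ _ (fun v => hess_ge v P0) (is_gain_sub PK PK'))).
have -> : c * (q%:R * (q%:R * `|B^T| * `|cl_mx K'|)) * `|P - P'| =
    c * (q%:R * (q%:R * (`|B^T| * `|P - P'|) * `|cl_mx K'|)) by ring.
rewrite ler_wpM2l// (le_trans (mulmx_norm_le _ _))// ler_wpM2l//.
by rewrite ler_wpM2r// mulmx_norm_le.
Qed.

Lemma cvg_gain (P : nat -> 'M[R]_q) (K : nat -> 'M[R]_(m, q)) P' K' :
  (forall k, psdmx (P k)) -> (forall k, is_gain (P k) (K k)) -> is_gain P' K' ->
  P @ \oo --> P' -> K @ \oo --> K'.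
Proof.
move=> P0 PK PK' PP; have [c c0 cK] := gain_dist K'.
apply/subr_cvg0; apply/norm_cvg0P.
apply: (@squeeze_cvg0 _ _ (fun k => c * `|P k - P'|)).
  by move=> k; rewrite normr_ge0/= cK.
rewrite -(mulr0 c); apply: cvgM; first exact: cvg_cst.
by apply/norm_cvg0P; exact/subr_cvg0.
Qed.

Lemma cvg_lyap_rhs (P : nat -> 'M[R]_q) (K : nat -> 'M[R]_(m, q)) P' K' z :
  P @ \oo --> P' -> K @ \oo --> K' ->
  (fun k => stage_cost z (K k *m z) + quadform (P k) (cl_mx (K k) *m z)) @ \oo
    --> stage_cost z (K' *m z) + quadform P' (cl_mx K' *m z).
Proof.
move=> PP KK.
have Kz : (fun k => K k *m z) @ \oo --> K' *m z by apply: cvg_mulmx => //; exact: cvg_cst.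
apply: cvgD.
  by apply: cvgD; [exact: cvg_cst|apply: cvg_quadform => //; exact: cvg_cst].
apply: cvg_quadform => //; rewrite /cl_mx mulmxBl -mulmxA.
under [X in X @ _]eq_fun do rewrite mulmxBl -mulmxA.
by apply: cvgB; [exact: cvg_cst|exact: cvg_mulmxr].
Qed.

(** [P] is the limit of value iteration, and [value_iterS] passes to the limit. Optimality is
    phrased with bounds on all partial sums, which also suits inputs of infinite cost. *)
Lemma riccati_solution : exists P K,
  [/\ P^T = P, psdmx P, is_gain P K, lyap K P &
    forall z u (c : R), lin_dyn z u ->
      (forall N, \sum_(t < N) stage_cost (z t) (u t) <= c) ->
      quadform P (z 0%N) <= c].
Proof.
have [c trc] := value_iter_tr_bounded.
have [|P Ps vP] := quadform_mono_cvg value_iter_sym (fun v k => value_iter_nd k v).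
  move=> v; exists (q%:R ^+ 2 * c * `|v| ^+ 2) => k.
  rewrite (le_trans (ler_norm _))// (le_trans (quadform_norm_le _ _))//.
  rewrite ler_wpM2r// ler_wpM2l//.
  by rewrite (le_trans (psd_norm_le_tr (value_iter_sym k) (value_iter_psd k))).
have vPz z : (fun k => quadform (value_iter k) z) @ \oo --> quadform P z.
  by apply: cvg_quadform => //; exact: cvg_cst.
have vPc z (d : R) : (forall k, quadform (value_iter k) z <= d) -> quadform P z <= d.
  move=> h; rewrite -(cvg_lim _ (vPz z))//; apply: limr_le; first exact: cvgP (vPz z).
  by near=> k; exact: h.
have P0 : psdmx P.
  exact: psd_limit vP value_iter_psd.
have PK := gainP P0.
have KK := cvg_gain value_iter_psd (fun k => gainP (value_iter_psd k)) PK vP.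
exists P, (gain P); split=> // [z|z u d zu zd].
  have vPS : (fun k => quadform (value_iter k.+1) z) @ \oo --> quadform P z.
    by have := vPz z; rewrite -(cvg_shiftS (fun k => quadform (value_iter k) z)).
  have := @cvg_lyap_rhs _ _ _ _ z vP KK; under eq_fun do rewrite -value_iterS.
  by move=> h; apply: (cvg_unique _ vPS h).
(* Horizon [k] with terminal matrix [value_iter 0 = 0], so that only stage costs remain. *)
apply: vPc => k; rewrite -[k]addn0 (le_trans (value_iter_dp _ _ zu))//.
by rewrite /= /quadform mulmx0 mul0mx mxE addr0; exact: zd.
Unshelve. all: by end_near.
Qed.

(** The cost matrix of the old gain decreases along the new closed loop by at least the stage cost,
    as the completed square shows. *)
Lemma policy_improvement K P K' : stable (cl_mx K) -> P^T = P -> lyap K P ->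
  is_gain P K' -> stable (cl_mx K').
Proof.
move=> Kst Psym KP PK'; have P0 := lyap_psd Kst KP.
apply: (decrease_stable P0) => z.
rewrite [leRHS]KP (complete_square_gain K z Psym PK') lerDl.
exact: hess_psd.
Qed.

(** A converse Lyapunov function, from the Stein equation with source [1%:M]; it serves as the
    weight in the convergence rate. *)
Lemma stable_quadratic_witness (F : 'M[R]_q) : stable F ->
  exists2 X : 'M[R]_q, psdmx X &
    forall v, quadform X v = quadform 1%:M v + quadform X (F *m v).
Proof.
move=> Fst; have [X XE] := stein_solvable 1%:M Fst.
have Xv v : quadform X v = quadform 1%:M v + quadform X (F *m v).
  by rewrite {1}XE quadform_addmx quadform_mul.
exists X => //; apply: (stable_decrease_psd Fst) => v.
by rewrite [leRHS]Xv lerDr (le_trans _ (norm_sqr_le v))// sqr_ge0.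
Qed.

(** * Policy iteration: convergence and quadratic rate *)

Section PolicyIteration.
Variables (Ps : 'M[R]_q) (Ks : 'M[R]_(m, q)).
Hypotheses (Ps_sym : Ps^T = Ps) (Ps_psd : psdmx Ps).
Hypotheses (Ps_gain : is_gain Ps Ks) (Ps_lyap : lyap Ks Ps).

(** Completing the square at [Ps] makes the stage costs of [K] cancel, leaving a Stein equation
    whose source is quadratic in [K - Ks]. *)
Lemma lyap_diff K P z : lyap K P -> quadform (P - Ps) z =
  quadform (P - Ps) (cl_mx K *m z) + quadform (hess Ps) ((K - Ks) *m z).
Proof.
move=> KP; have := complete_square_gain K z Ps_sym Ps_gain.
by rewrite -Ps_lyap !quadform_submx KP => h; lra.
Qed.

Lemma lyap_ge_opt K P : stable (cl_mx K) -> lyap K P -> psdmx (P - Ps).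
Proof.
move=> Kst KP; apply: (stable_decrease_psd Kst) => z.
by rewrite [leRHS](lyap_diff _ KP) lerDl hess_psd.
Qed.

(* With [E = K - Ks], the matrix [2 s |E|^2 X - (P - Ps)] decreases along the
   closed loop of [K], so that [P - Ps] is of the order of [|E|^2]; the next
   gain error is linear in [P - Ps]. *)
Lemma gain_error_quadratic : exists2 c : R, 0 <= c & forall K P K' X,
  stable (cl_mx K) -> P^T = P -> lyap K P -> is_gain P K' ->
  (forall v, quadform X (cl_mx K *m v) + 1 / 2 * quadform 1%:M v <= quadform X v) ->
  `|K' - Ks| <= c * \tr X * `|K - Ks| ^+ 2.
Proof.
have [c c0 cK] := gain_dist Ks.
pose s : R := m%:R ^+ 2 * `|hess Ps| * q%:R ^+ 2.
have s0 : 0 <= s by rewrite !mulr_ge0.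
exists (c * (2 * s)); first by rewrite !mulr_ge0.
move=> K P K' X Kst Psym KP PK' XK.
have P0 := lyap_psd Kst KP; have D0 := lyap_ge_opt Kst KP.
have Dsym : (P - Ps)^T = P - Ps by rewrite linearB/= Psym Ps_sym.
set E := K - Ks.
(* The factor [2] lets the decrease of [X], only half of [quadform 1%:M], pay for the source term
   bounded in [Ez]. *)
pose g := 2 * s * `|E| ^+ 2.
have Ez z : quadform (hess Ps) (E *m z) <= s * `|E| ^+ 2 * quadform 1%:M z.
  rewrite (le_trans (ler_norm _))// (le_trans (quadform_norm_le _ _))//.
  have Ezn : `|E *m z| ^+ 2 <= (q%:R * (`|E| * `|z|)) ^+ 2.
    by rewrite ler_sqr ?nnegrE ?mulr_ge0// mulmx_norm_le.
  have -> : s * `|E| ^+ 2 * quadform 1%:M z =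
      m%:R ^+ 2 * `|hess Ps| * (q%:R ^+ 2 * `|E| ^+ 2 * quadform 1%:M z).
    by rewrite /s; ring.
  rewrite ler_wpM2l ?mulr_ge0// (le_trans Ezn)// !exprMn mulrA ler_wpM2l//.
  exact: norm_sqr_le.
have gXD : psdmx (g *: X - (P - Ps)).
  apply: (stable_decrease_psd Kst) => z.
  rewrite !quadform_submx !quadform_scalemx -!quadform_submx.
  rewrite [X in _ <= _ - X](lyap_diff _ KP).
  have := Ez z; rewrite -/E => Ez'.
  have g0 : 0 <= g by rewrite !mulr_ge0// sqr_ge0.
  have := ler_wpM2l g0 (XK z).
  rewrite mulrDr.
  have -> : g * (1 / 2 * quadform 1%:M z) = s * `|E| ^+ 2 * quadform 1%:M z.
    by rewrite /g; field.
  lra.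
rewrite (le_trans (cK _ _ _ P0 PK' Ps_gain))//.
have -> : c * (2 * s) * \tr X * `|E| ^+ 2 = c * (g * \tr X).
  by rewrite /g; ring.
rewrite ler_wpM2l// (le_trans (psd_norm_le_tr Dsym D0))//.
rewrite /mxtrace mulr_sumr ler_sum// => i _.
have := gXD (delta_mx i 0).
by rewrite quadform_submx quadform_scalemx !quadform_delta subr_ge0.
Qed.

Section Sequence.
Variables (K : nat -> 'M[R]_(m, q)) (P : nat -> 'M[R]_q).
Hypotheses (K_stable : forall i, stable (cl_mx (K i))).
Hypotheses (P_sym : forall i, (P i)^T = P i) (KP : forall i, lyap (K i) (P i)).
Hypothesis PK : forall i, is_gain (P i) (K i.+1).

Lemma policy_iteration_psd i : psdmx (P i).
Proof. exact: (lyap_psd (@K_stable i) (KP i)). Qed.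

(** Along the closed loop of the improved gain, [P i - P i.+1] decreases by the completed square at
    [P i]. *)
Lemma policy_iteration_noninc i v :
  quadform (P i.+1) v <= quadform (P i) v.
Proof.
rewrite -subr_ge0 -quadform_submx.
apply: (stable_decrease_psd (@K_stable i.+1)) => z.
rewrite !quadform_submx (KP i z) (KP i.+1 z).
rewrite (complete_square_gain (K i) z (P_sym i) (PK i)).
have := hess_psd (policy_iteration_psd i) ((K i - K i.+1) *m z).
lra.
Qed.

(** The decreasing costs have a limit satisfying the Lyapunov equation of its own gain. Comparison
    with [Ps] from both sides identifies it, and gains depend continuously on costs. *)
Lemma policy_iteration_cvg : K @ \oo --> Ks.
Proof.
have [|||L Lsym NL] := @quadform_mono_cvg _ _ (fun i => - P i).
- by move=> i; rewrite linearN/= P_sym.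
- by move=> v i; rewrite !quadform_oppmx lerN2 policy_iteration_noninc.
- move=> v; exists 0 => i.
  by rewrite quadform_oppmx oppr_le0 policy_iteration_psd.
have PL : P @ \oo --> - L.
  by rewrite -[P]opprK; apply: cvgN; exact: NL.
have L's : (- L)^T = - L by rewrite linearN/= Lsym.
move: (- L) PL L's => L' PL L's; clear L Lsym NL.
have L'0 := psd_limit PL policy_iteration_psd.
(* [K i.+1] is the gain of [P i], but its Lyapunov equation involves [P i.+1]; both sequences of
   costs have the same limit. *)
have PSL : (fun i => P i.+1) @ \oo --> L' by move: PL; rewrite -(cvg_shiftS P).
have KSL : (fun i => K i.+1) @ \oo --> gain L'.
  exact: cvg_gain policy_iteration_psd PK (gainP L'0) PL.
have L'lyap : lyap (gain L') L'.
  move=> z; have := @cvg_lyap_rhs _ _ _ _ z PSL KSL.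
  have : (fun i => quadform (P i.+1) z) @ \oo --> quadform L' z.
    by apply: cvg_quadform => //; exact: cvg_cst.
  under eq_fun do rewrite (KP _ z).
  by move=> h1 h2; apply: (cvg_unique _ h1 h2).
have L'ge : psdmx (L' - Ps).
  apply: (@psd_limit _ _ (fun i => P i - Ps)).
    by apply: cvgB => //; exact: cvg_cst.
  by move=> i; exact: (lyap_ge_opt (@K_stable i) (KP i)).
(* Comparison along the closed loop of [Ks]: in the one-step problem with cost [L'], its own gain
   does at least as well as [Ks]. *)
have L'le : psdmx (Ps - L').
  apply: (stable_decrease_psd (lyap_stable Ps_psd Ps_lyap)) => z.
  rewrite !quadform_submx (Ps_lyap z) (L'lyap z).
  have := complete_square_gain Ks z L's (gainP L'0).
  have := hess_psd L'0 ((Ks - gain L') *m z); lra.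
have L'E : L' = Ps.
  apply: quadform_inj => // v.
  have := L'le v; have := L'ge v; rewrite !quadform_submx => h1 h2.
  by apply/eqP; rewrite eq_le -subr_ge0 h2 -subr_ge0.
have : (fun i => K i.+1) @ \oo --> Ks.
  by apply: cvg_gain policy_iteration_psd PK Ps_gain _; rewrite -L'E.
by rewrite cvg_shiftS.
Qed.

(** For large [i] a single [X], built from the closed loop of [Ks], serves all [K i], since a small
    change of gain costs at most half of its decrease. Each of the finitely many earlier gains has
    its own [X]. *)
Lemma policy_iteration_rate :
  exists c : R, forall i, `|K i.+1 - Ks| <= c * `|K i - Ks| ^+ 2.
Proof.
have [c c0 cX] := gain_error_quadratic.
apply: eventually_bounded_ratio => [i|i|].
- exact: sqr_ge0.
- have [X X0 XF] := stable_quadratic_witness (@K_stable i).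
  exists (c * \tr X); apply: (cX _ (P i)) => // v.
  rewrite [leRHS]XF addrC lerD2r.
  have := le_trans (sqr_ge0 _) (norm_sqr_le v); lra.
have [X X0 XF] := stable_quadratic_witness (lyap_stable Ps_psd Ps_lyap).
pose G K' := (cl_mx K')^T *m X *m cl_mx K'.
have clK : (fun i => cl_mx (K i)) @ \oo --> cl_mx Ks.
  by apply: cvgB; [exact: cvg_cst|apply: cvg_mulmxr; exact: policy_iteration_cvg].
have GK : (fun i => G (K i)) @ \oo --> G Ks.
  apply: cvg_mulmx => //; apply: cvg_mulmx; last exact: cvg_cst.
  exact: cvg_trmx.
have : (fun i => q%:R ^+ 2 * `|G (K i) - G Ks|) @ \oo --> (0 : R).
  rewrite -(mulr0 (q%:R ^+ 2)); apply: cvgM; first exact: cvg_cst.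
  by apply/norm_cvg0P; exact/subr_cvg0.
move/cvgrPdist_le => /(_ (1/2)); case; first by rewrite divr_gt0.
move=> N _ GN; exists N, (c * \tr X) => i Ni; apply: (cX _ (P i)) => // v.
have := GN i Ni; rewrite /= sub0r normrN => /(le_trans (ler_norm _)) GNi.
have v0 := le_trans (sqr_ge0 _) (norm_sqr_le v).
have h1 : quadform (G (K i) - G Ks) v <= 1 / 2 * quadform 1%:M v.
  rewrite (le_trans (ler_norm _))// (le_trans (quadform_norm_le _ _))//.
  by rewrite (le_trans (ler_wpM2r (sqr_ge0 _) GNi))// ler_wpM2l// norm_sqr_le.
rewrite [leRHS]XF !quadform_mul -/(G _) -/(G _).
move: h1; rewrite quadform_submx; lra.
Qed.
End Sequence.
End PolicyIteration.
End LinearQuadraticRegulator.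

(** * Eigenvalues and stability *)

Section Schur.
Variable R : realType.
Local Open Scope complex_scope.

(** Induction on the factors: [w' = (M - lam) w] is again an orbit of [M], annihilated by the
    remaining product, and it is the error term in the recursion for [w]. The real-valued
    [Normc.normc] keeps all limits in [R]. *)
Lemma factored_orbit_cvg0 (q : nat) (M : 'M[R[i]]_q.+1) (s : seq R[i])
    (w : nat -> 'cV[R[i]]_q.+1) :
  (forall t, w t.+1 = M *m w t) -> {in s, forall lam, Normc.normc lam < 1} ->
  (forall t, horner_mx M (\prod_(lam <- s) ('X - lam%:P)) *m w t = 0) ->
  forall i, (fun t => Normc.normc (w t i 0)) @ \oo --> (0 : R).
Proof.
elim: s w => [|lam s IH] w wM s1 w0 i.
  have w00 t : w t = 0 by have := w0 t; rewrite big_nil rmorph1 mul1mx.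
  under eq_fun do rewrite w00 mxE Normc.normc0.
  exact: cvg_cst.
pose w' t := M *m w t - lam *: w t.
have w'c : forall i, (fun t => Normc.normc (w' t i 0)) @ \oo --> (0 : R).
  apply: IH => [t|mu mus|t].
  - by rewrite /w' wM mulmxBr -scalemxAr.
  - by apply: s1; rewrite inE mus orbT.
  - have := w0 t; rewrite big_cons mulrC rmorphM /= => <-.
    rewrite -[in RHS]mulmxA; congr (_ *m _).
    by rewrite rmorphB /= horner_mx_X horner_mx_C mulmxBl mul_scalar_mx.
apply: (contraction_cvg0 (r := Normc.normc lam) _ _ _ (w'c i)).
- by rewrite s1 ?mem_head// andbT; case: (lam) => a b; exact: sqrtr_ge0.
- by move=> t; case: (w t i 0) => a b; exact: sqrtr_ge0.
- move=> t; have -> : w t.+1 i 0 = lam * w t i 0 + w' t i 0.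
    by rewrite /w' wM; move: (M *m w t) => v; rewrite !mxE; ring.
  by rewrite (le_trans (le_normcD _ _))// Normc.normcM.
Qed.

(* Cayley-Hamilton: [prod_lam (M - lam) = 0] over the eigenvalues, and each
   factor is removed by the scalar recursion [a_(t+1) = lam a_t + e_t]. *)
Lemma schur_stable (q : nat) (F : 'M[R]_q) : schur F -> stable F.
Proof.
case: q F => [|q] F Fs z zF.
  by apply/cvg_mxP => -[].
pose M := map_mx (real_complex R) F.
pose w t := map_mx (real_complex R) (z t).
have wM t : w t.+1 = M *m w t by rewrite /w zF map_mxM.
have [s Ms] := closed_field_poly_normal (char_poly M).
have {Ms}Ms : char_poly M = \prod_(lam <- s) ('X - lam%:P).
  by rewrite Ms (monicP (char_poly_monic M)) scale1r.
have s1 : {in s, forall lam, Normc.normc lam < 1}.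
  move=> lam lams; have : eigenvalue M lam.
    by rewrite eigenvalue_root_char Ms root_prod_XsubC.
  by move/Fs; rewrite normc_def ltcR; case: (lam).
have wc := factored_orbit_cvg0 wM s1 _.
apply/cvg_mxP => i j; rewrite ord1 mxE; apply/norm_cvg0P.
have -> : (fun t => `|z t i 0|) = (fun t => Normc.normc (w t i 0)).
  apply/funext => t; rewrite mxE /Normc.normc/= expr0n/= addr0.
  by rewrite sqrtr_sqr.
by apply: wc => t; rewrite -Ms Cayley_Hamilton mul0mx.
Qed.
End Schur.

(** * Windows of signals and the lifted system *)

Section Data.
Variable R : realType.

Lemma col_hcat (q k : nat) (v : 'I_k -> 'cV[R]_q) j : col j (hcat v) = v j.
Proof. by apply/colP => i; rewrite !mxE. Qed.

Lemma cols_inj (a b : nat) (M N : 'M[R]_(a, b)) :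
  (forall j, col j M = col j N) -> M = N.
Proof. by move=> MN; apply/matrixP => i j; move/colP: (MN j) => /(_ i); rewrite !mxE. Qed.

Lemma mulmx_hcat (a q k : nat) (M : 'M[R]_(a, q)) (v : 'I_k -> 'cV[R]_q) :
  M *m hcat v = hcat (fun j => M *m v j).
Proof. by apply: cols_inj => j; rewrite colE -mulmxA -colE !col_hcat. Qed.

Lemma hcat_mulmx (q k : nat) (v : 'I_k -> 'cV[R]_q) (c : 'cV[R]_k) :
  hcat v *m c = \sum_j c j 0 *: v j.
Proof.
apply/colP => i; rewrite mxE summxE; apply: eq_bigr => j _.
by rewrite !mxE mulrC.
Qed.

Lemma hcat_col_mx (a b k : nat) (v : 'I_k -> 'cV[R]_a) (w : 'I_k -> 'cV[R]_b) :
  hcat (fun j => col_mx (v j) (w j)) = col_mx (hcat v) (hcat w).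
Proof.
apply: cols_inj => j; rewrite col_hcat col_col_mx.
by rewrite !col_hcat.
Qed.

Lemma submxcol_window (q : nat) (w : nat -> 'cV[R]_q) a k (i : 'I_k) :
  submxcol (window w a k) i = w (a + i)%N.
Proof. by rewrite mxcolK. Qed.

Lemma eq_window (q : nat) (w w' : nat -> 'cV[R]_q) a a' k :
  (forall i, (i < k)%N -> w (a + i)%N = w' (a' + i)%N) ->
  window w a k = window w' a' k.
Proof. by move=> ww; apply: eq_mxcol => i; exact: ww. Qed.

Lemma cvg_window0 (q : nat) (w : nat -> 'cV[R]_q) k :
  w @ \oo --> (0 : 'cV[R]_q) ->
  (fun t => window w t k) @ \oo --> (0 : 'cV[R]_(stackdim q k)).
Proof.
move=> w0; apply/cvg_mxP => i j; rewrite mxE.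
under eq_fun do rewrite mxE.
set a := tagnat.sig1 i; set b := tagnat.sig2 i.
have /cvg_mxP/(_ b j) : (fun t => w (t + a)%N) @ \oo --> (0 : 'cV[R]_q).
  by rewrite cvg_shiftn.
by rewrite mxE.
Qed.

(* The casts of [gamma_from_data] vanish once the number [s] of rows of the
   output data is replaced by [eta + r]. *)
Lemma first_rows_of_perm (eta r s c nu : nat) (e : (eta + r = s)%N)
    (Pi : 'M[R]_s) (U : 'M[R]_(c, nu)) (Y : 'M[R]_(s, nu))
    (M : 'M[R]_(c + eta, nu)) (N : 'M[R]_(r, nu)) :
  Pi \in unitmx ->
  col_mx U Y = block_mx 1%:M 0 0 Pi *m
    castmx (etrans (esym (addnA _ _ _)) (congr1 (addn _) e), erefl) (col_mx M N) ->
  col_mx U (usubmx (castmx (esym e, erefl) (invmx Pi)) *m Y) = M.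
Proof.
case: s / e Pi Y => /= Pi Y Piu.
rewrite -[M]vsubmxK; move: (usubmx M) (dsubmx M) => Mu Md; clear M.
have -> : castmx (etrans (esym (addnA c eta r)) (erefl _), erefl)
    (col_mx (col_mx Mu Md) N) = col_mx Mu (col_mx Md N).
  by rewrite [RHS]col_mxA; congr (castmx (_, _) _); exact: eq_irrelevance.
rewrite mul_block_col !mul1mx !mul0mx addr0 add0r => /eq_col_mx[-> ->].
by rewrite castmx_id mul_usub_mx mulKmx// col_mxKu.
Qed.
End Data.

(** * Trajectories of the lifted linear system and their generating data *)

Section LiftedSystem.
Variables (R : realType) (m p eta l : nat).
Variables (A : 'M[R]_eta) (B : 'M[R]_(eta, m)) (C : 'M[R]_(p, eta)).
Variable Gamma : 'M[R]_(eta, stackdim p l).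
Implicit Types (xi : nat -> 'cV[R]_eta) (u : nat -> 'cV[R]_m).
Implicit Type y : nat -> 'cV[R]_p.

Lemma zvecE u y t :
  zvec Gamma u y (l + t) = col_mx (window u t l) (Gamma *m window y t l).
Proof. by rewrite /zvec addKn. Qed.

Lemma eq_zvec u u' y y' t t' :
  (forall i, (i < l)%N -> u (t - l + i)%N = u' (t' - l + i)%N) ->
  (forall i, (i < l)%N -> y (t - l + i)%N = y' (t' - l + i)%N) ->
  zvec Gamma u y t = zvec Gamma u' y' t'.
Proof. by move=> uu yy; rewrite /zvec (eq_window uu) (eq_window yy). Qed.

Lemma zvec_cvg0 u y : u @ \oo --> (0 : 'cV[R]_m) -> y @ \oo --> (0 : 'cV[R]_p) ->
  (fun t => zvec Gamma u y (l + t)) @ \oo --> (0 : 'cV[R]_(stackdim m l + eta)).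
Proof.
move=> u0 y0; rewrite (funext (zvecE u y)).
rewrite -(@col_mx0 R _ _ 1); apply: cvg_col_mx; first exact: cvg_window0.
by rewrite -(mulmx0 _ Gamma); apply: cvg_mulmxr; exact: cvg_window0.
Qed.

Lemma lifted_traj_shift s xi u y : lifted_traj A B C xi u y ->
  lifted_traj A B C (fun t => xi (s + t)%N) (fun t => u (s + t)%N)
    (fun t => y (s + t)%N).
Proof. by move=> xuy t; rewrite addnS. Qed.

Fixpoint lifted_state (xi0 : 'cV[R]_eta) u t : 'cV[R]_eta :=
  if t is t'.+1 then A *m lifted_state xi0 u t' + B *m u t' else xi0.

Lemma lifted_stateP (xi0 : 'cV[R]_eta) u : lifted_traj A B C (lifted_state xi0 u) u
  (fun t => C *m lifted_state xi0 u t).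
Proof. by []. Qed.

(** Linear dependence on the data [D] with one matrix for all trajectories. Only its existence
    matters, so convolution matrices are never written out. *)
Definition determined (k b : nat)
    (D : (nat -> 'cV[R]_eta) -> (nat -> 'cV[R]_m) -> 'cV[R]_k)
    (g : (nat -> 'cV[R]_eta) -> (nat -> 'cV[R]_m) -> (nat -> 'cV[R]_p) -> 'cV[R]_b) :
    Prop :=
  exists X : 'M[R]_(b, k), forall xi u y,
    lifted_traj A B C xi u y -> g xi u y = X *m D xi u.

Section Determined.
Variables (k N : nat) (D : (nat -> 'cV[R]_eta) -> (nat -> 'cV[R]_m) -> 'cV[R]_k).
Hypothesis D0 : determined D (fun xi _ _ => xi 0%N).
Hypothesis Du : forall i, (i < N)%N -> determined D (fun _ u _ => u i).

Lemma determined_state t : (t <= N)%N -> determined D (fun xi _ _ => xi t).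
Proof.
elim: t => // t IH tN; have [X Xt] := IH (ltnW tN); have [E Et] := Du tN.
exists (A *m X + B *m E) => xi u y xuy.
by rewrite (xuy t).1 mulmxDl -!mulmxA (Xt _ _ _ xuy) (Et _ _ _ xuy).
Qed.

Lemma determined_output t : (t <= N)%N -> determined D (fun _ _ y => y t).
Proof.
move=> /determined_state[X Xt]; exists (C *m X) => xi u y xuy.
by rewrite (xuy t).2 -mulmxA (Xt _ _ _ xuy).
Qed.

Lemma determined_zvec t : (l + t <= N)%N ->
  determined D (fun _ u y => zvec Gamma u y (l + t)).
Proof.
move=> ltN.
have /choice[E EP] : forall i : 'I_l, exists X : 'M[R]_(m, k), forall xi u y,
    lifted_traj A B C xi u y -> u (t + i)%N = X *m D xi u.
  by move=> i; apply: Du; rewrite (leq_trans _ ltN)// addnC ltn_add2r.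
have /choice[Y YP] : forall i : 'I_l, exists X : 'M[R]_(p, k), forall xi u y,
    lifted_traj A B C xi u y -> y (t + i)%N = X *m D xi u.
  move=> i; apply: determined_output; rewrite (leq_trans _ ltN)// addnC leq_add2r.
  exact: ltnW.
exists (col_mx (\mxcol_(i < l) E i) (Gamma *m \mxcol_(i < l) Y i)) => xi u y xuy.
rewrite zvecE mul_col_mx -mulmxA !mxcol_mul; congr col_mx; last congr (_ *m _).
  by apply: eq_mxcol => i; exact: EP xuy.
by apply: eq_mxcol => i; exact: YP xuy.
Qed.
End Determined.

(** Free coordinates of a lifted trajectory over a window of length [l]: the inputs in it and the
    state at its start. *)
Definition initial_data xi u : 'cV[R]_(stackdim m l + eta) :=
  col_mx (window u 0 l) (xi 0%N).

Lemma initial_data_state : determined initial_data (fun xi _ _ => xi 0%N).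
Proof.
exists (row_mx 0 1%:M) => xi u y _.
by rewrite mul_row_col mul0mx mul1mx add0r.
Qed.

Lemma initial_data_input i : (i < l)%N ->
  determined initial_data (fun _ u _ => u i).
Proof.
move=> il.
exists (row_mx (submxcol (1%:M : 'M[R]_(stackdim m l)) (Ordinal il)) 0) => xi u y _.
by rewrite mul_row_col mul0mx addr0 submxcol_mul mul1mx submxcol_window.
Qed.

Lemma zvec_from_initial_data : exists S : 'M[R]_(stackdim m l + eta),
  forall xi u y, lifted_traj A B C xi u y ->
    zvec Gamma u y l = S *m initial_data xi u.
Proof.
have [|S SP] := @determined_zvec _ l _ initial_data_state initial_data_input 0.
  by rewrite addn0.
by exists S => xi u y /SP; rewrite addn0.
Qed.

Lemma zvec_next_from_initial_data :
  exists (S : 'M[R]_(stackdim m l + eta)) (U : 'M[R]_(stackdim m l + eta, m)),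
  forall xi u y, lifted_traj A B C xi u y ->
    zvec Gamma u y l.+1 = S *m initial_data xi u + U *m u l.
Proof.
(* The window ending one step later also involves [u l]; splitting the columns of the resulting
   matrix separates its contribution. *)
pose D xi u := col_mx (initial_data xi u) (u l).
have [|||S SP] := @determined_zvec _ l.+1 D _ _ 1.
- have [X XP] := initial_data_state.
  exists (row_mx X 0) => xi u y /XP ->.
  by rewrite mul_row_col mul0mx addr0.
- move=> i; rewrite ltnS leq_eqVlt => /predU1P[->|il].
    exists (row_mx 0 1%:M) => xi u y _.
    by rewrite mul_row_col mul0mx mul1mx add0r.
  have [X XP] := initial_data_input il.
  exists (row_mx X 0) => xi u y /XP ->.
  by rewrite mul_row_col mul0mx addr0.
- by rewrite addn1.
exists (lsubmx S), (rsubmx S) => xi u y /SP; rewrite addn1 => ->.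
by rewrite -{1}[S]hsubmxK mul_row_col.
Qed.

Lemma lifted_traj_of_initial_data d (v : nat -> 'cV[R]_m) : exists xi u y,
  [/\ lifted_traj A B C xi u y, initial_data xi u = d
    & forall t, u (l + t)%N = v t].
Proof.
(* [insub t] succeeds exactly when [t < l]: earlier inputs are blocks of [d], later ones come from
   [v]. *)
pose u t := if insub t is Some i then submxcol (usubmx d) i else v (t - l)%N.
exists (lifted_state (dsubmx d) u), u, (fun t => C *m lifted_state (dsubmx d) u t).
split; first exact: lifted_stateP.
- rewrite /initial_data -[RHS]vsubmxK; congr col_mx.
  rewrite -[RHS]submxcolK; apply: eq_mxcol => i.
  by rewrite add0n /u valK.
- by move=> t; rewrite /u insubF ?addKn// ltnNge leq_addr.
Qed.
End LiftedSystem.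

(** * The nonlinear system in the coordinates z *)

Section KoopmanSystem.
Variables (R : realType) (n m p eta : nat).
Variables (f : 'cV[R]_n -> 'cV[R]_m -> 'cV[R]_n) (h : 'cV[R]_n -> 'cV[R]_p).
Variable psi : 'I_eta -> 'cV[R]_n -> R.
Variables (A : 'M[R]_eta) (B : 'M[R]_(eta, m)) (C : 'M[R]_(p, eta)).
Hypothesis kle : koopman_embedding f h psi A B C.

Fixpoint sim (x0 : 'cV[R]_n) (u : nat -> 'cV[R]_m) t : 'cV[R]_n :=
  if t is t'.+1 then f (sim x0 u t') (u t') else x0.

Lemma sim_traj x0 u : sys_traj f h (sim x0 u) u (fun t => h (sim x0 u t)).
Proof. by []. Qed.

Lemma koopman_lifted x u y : sys_traj f h x u y ->
  lifted_traj A B C (fun t => lift_state psi (x t)) u y.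
Proof. exact: kle.2. Qed.

(** * Decay and stabilizability of the lifted state *)

Section Continuity.
Hypothesis fcont : continuous (fun w : 'cV[R]_n * 'cV[R]_m => f w.1 w.2).
Hypotheses (hcont : continuous h) (f00 : f 0 0 = 0) (h0 : h 0 = 0).
Hypothesis obs : observable A C.

Lemma cvg_sim0 (x : nat -> 'cV[R]_n) i : x @ \oo --> (0 : 'cV[R]_n) ->
  (fun t => sim (x t) (fun=> 0) i) @ \oo --> (0 : 'cV[R]_n).
Proof.
move=> x0; elim: i => [//|i IH] /=.
have := continuous_cvg (F := \oo) _ (@fcont (0, 0))
  (cvg_pair IH (cvg_cst (0 : 'cV[R]_m))).
by rewrite /= f00; exact.
Qed.

(* [C A^i psi(x)] is the [i]-th output of the unforced system started at [x],
   so observability makes [psi] a linear image of a continuous function. *)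
Lemma lift_state_cvg0 (x : nat -> 'cV[R]_n) : x @ \oo --> (0 : 'cV[R]_n) ->
  (fun t => lift_state psi (x t)) @ \oo --> (0 : 'cV[R]_eta).
Proof.
move=> x0.
have /row_fullP[L LO] : row_full (obsmx A C eta) by rewrite /row_full obs.
have outE z i : C *m A ^+ i *m lift_state psi z = h (sim z (fun=> 0) i).
  have zt := koopman_lifted (sim_traj z (fun=> 0)).
  rewrite (zt i).2 -mulmxA; congr (_ *m _).
  elim: i => [|i IH]; first by rewrite expr0 mul1mx.
  rewrite (zt i).1 mulmx0 addr0 -IH mulmxA; congr (_ *m _).
  by rewrite exprS.
have -> : (fun t => lift_state psi (x t)) =
    (fun t => L *m \mxcol_(i < eta) h (sim (x t) (fun=> 0) i)).
  apply/funext => t; rewrite -[LHS]mul1mx -LO -mulmxA; congr (_ *m _).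
  by rewrite mxcol_mul; apply: eq_mxcol => i; exact: outE.
rewrite -(mulmx0 _ L); apply: cvg_mulmxr.
apply/cvg_mxP => i j; rewrite mxE; under eq_fun do rewrite mxE.
have : (fun t => h (sim (x t) (fun=> 0) (tagnat.sig1 i))) @ \oo --> (0 : 'cV[R]_p).
  by rewrite -h0; apply: continuous_cvg; [exact: hcont|exact: cvg_sim0].
by move/cvg_mxP => /(_ (tagnat.sig2 i) j); rewrite mxE.
Qed.

Hypothesis stab : stabilizable f.

(** Superposed lifts of stabilized nonlinear trajectories form a trajectory of the linear system,
    although the sum itself need not be the lift of any nonlinear state. *)
Lemma lifted_stabilizable (nu : nat) (x0 : 'I_nu -> 'cV[R]_n) (c : 'I_nu -> R) :
  exists xi u, [/\ xi 0%N = \sum_j c j *: lift_state psi (x0 j),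
    forall t, xi t.+1 = A *m xi t + B *m u t,
    xi @ \oo --> (0 : 'cV[R]_eta) & u @ \oo --> (0 : 'cV[R]_m)].
Proof.
have /choice[xu xuP] : forall j, exists xu : (nat -> 'cV[R]_n) * (nat -> 'cV[R]_m),
    [/\ xu.1 0%N = x0 j, forall t, xu.1 t.+1 = f (xu.1 t) (xu.2 t)
      & xu.1 @ \oo --> (0 : 'cV[R]_n)].
  by move=> j; have [x [u xu]] := stab (x0 j); exists (x, u).
pose xi t := \sum_j c j *: lift_state psi ((xu j).1 t).
pose u t := \sum_j c j *: (xu j).2 t.
have xiS t : xi t.+1 = A *m xi t + B *m u t.
  rewrite /xi /u !mulmx_sumr -big_split/=; apply: eq_bigr => j _.
  have [_ xuS _] := xuP j.
  have : sys_traj f h (xu j).1 (xu j).2 (fun t => h ((xu j).1 t)) by [].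
  move/koopman_lifted => /(_ t)[-> _].
  by rewrite scalerDr -!scalemxAr.
have xi0 : xi @ \oo --> (0 : 'cV[R]_eta).
  apply/cvg_mxP => i k; rewrite mxE.
  have -> : (fun t => xi t i k) =
      (fun t => \sum_j c j * lift_state psi ((xu j).1 t) i k).
    by apply/funext => t; rewrite summxE; apply: eq_bigr => j _; rewrite mxE.
  have sum0 : \sum_(j < nu) c j * 0 = 0 :> R.
    by rewrite big1// => j _; rewrite mulr0.
  have := @cvg_sum _ _ (fun j t => c j * lift_state psi ((xu j).1 t) i k) (fun j => c j * 0).
  rewrite sum0; apply=> j; apply: cvgM; first exact: cvg_cst.
  have [_ _ /lift_state_cvg0/cvg_mxP/(_ i k)] := xuP j.
  by rewrite mxE.
have Bu0 : (fun t => B *m u t) @ \oo --> (0 : 'cV[R]_eta).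
  have -> : (fun t => B *m u t) = (fun t => xi t.+1 - A *m xi t).
    by apply/funext => t; rewrite xiS addrC addKr.
  have -> : (0 : 'cV[R]_eta) = 0 - A *m 0 by rewrite mulmx0 subr0.
  apply: cvgB.
    by move: xi0; rewrite -(cvg_shiftS xi).
  exact: cvg_mulmxr.
(* The original inputs need not decay, but [B u] does. Projecting them with [pinvmx B *m B] keeps
   the dynamics and yields decaying inputs. *)
exists xi, (fun t => pinvmx B *m (B *m u t)); split=> //.
- by apply: eq_bigr => j _; have [-> _ _] := xuP j.
- by move=> t; rewrite xiS; congr (_ + _); rewrite [RHS]mulmxA [RHS]mulmxA mulmxKpV.
- by rewrite -(mulmx0 _ (pinvmx B)); exact: cvg_mulmxr.
Qed.
End Continuity.

(** Prolongs the finite samples by simulation, so that facts about whole trajectories apply to the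
    data. *)
Lemma data_traj_extend (l nu : nat) (ud : 'I_nu -> nat -> 'cV[R]_m)
    (yd : 'I_nu -> nat -> 'cV[R]_p) : data_traj l f h ud yd ->
  exists (x : 'I_nu -> nat -> 'cV[R]_n) (y : 'I_nu -> nat -> 'cV[R]_p),
    forall j, sys_traj f h (x j) (ud j) (y j) /\
      (forall t, (t <= l)%N -> yd j t = y j t).
Proof.
move=> /choice[x xP].
exists (fun j => sim (x j 0%N) (ud j)), (fun j t => h (sim (x j 0%N) (ud j) t)).
move=> j; split=> // t tl; have [xS ->] := xP j => //; congr h.
elim: t tl => // t IH tl; by rewrite /= -IH ?xS// ltnW.
Qed.

(** * The linear system satisfied by z *)

Section Realization.
Variables (l nu : nat) (ud : 'I_nu -> nat -> 'cV[R]_m) (yd : 'I_nu -> nat -> 'cV[R]_p).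
Variable Gamma : 'M[R]_(eta, stackdim p l).
Hypothesis fcont : continuous (fun w : 'cV[R]_n * 'cV[R]_m => f w.1 w.2).
Hypotheses (hcont : continuous h) (f00 : f 0 0 = 0) (h0 : h 0 = 0).
Hypotheses (obs : observable A C) (stab : stabilizable f).
Hypotheses (data : data_traj l f h ud yd) (alg1 : gamma_from_data ud yd Gamma).

(** The matrix with columns [z_l^j] is the matrix [M] of Algorithm 1. *)
Lemma gamma_row_free :
  row_free (hcat (fun j => zvec Gamma (ud j) (yd j) l)).
Proof.
have [e [Pi [M [N [/is_perm_mxP[s ->] pd Mfree ->]]]]] := alg1.
rewrite -(first_rows_of_perm (unitmx_perm _ s) pd) in Mfree; move: Mfree.
by rewrite mulmx_hcat -hcat_col_mx /zvec subnn.
Qed.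

(** The data matrix of [z_l] factors as [S *m D]. Its full row rank forces the square [S] to be
    invertible and [D] to have full row rank, so the lifted initial states of the data span the
    lifted space. *)
Lemma initial_data_bijective :
  exists (S : 'M[R]_(stackdim m l + eta)) (x0 : 'I_nu -> 'cV[R]_n),
  [/\ S \in unitmx,
    forall xi u y, lifted_traj A B C xi u y ->
      zvec Gamma u y l = S *m initial_data l xi u
    & forall xi0 : 'cV[R]_eta, exists c : 'I_nu -> R,
      xi0 = \sum_j c j *: lift_state psi (x0 j)].
Proof.
have [S SP] := zvec_from_initial_data A B C Gamma.
have [x [y xyP]] := data_traj_extend data.
pose D := hcat (fun j => initial_data l (fun t => lift_state psi (x j t)) (ud j)).
have SD : row_free (S *m D).
  have := gamma_row_free; rewrite mulmx_hcat.
  suff -> : hcat (fun j => zvec Gamma (ud j) (yd j) l) =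
    hcat (fun j => S *m initial_data l (fun t => lift_state psi (x j t)) (ud j)) by [].
  congr hcat; apply/funext => j; have [xj yj] := xyP j.
  rewrite -(SP _ _ _ (koopman_lifted xj)).
  by apply: eq_zvec => // i il; rewrite subnn add0n yj// ltnW.
have Su : S \in unitmx.
  rewrite -row_free_unit /row_free eqn_leq rank_leq_row /=.
  by rewrite -{1}(eqP SD) mxrankM_maxl.
exists S, (fun j => x j 0%N); split=> // xi0.
have /row_freeP[E DE] : row_free D.
  by rewrite /row_free eqn_leq rank_leq_row /= -{1}(eqP SD) mxrankM_maxr.
pose c := E *m col_mx (0 : 'cV[R]_(stackdim m l)) xi0.
exists (fun j => c j 0).
have : D *m c = col_mx 0 xi0 by rewrite mulmxA DE mul1mx.
rewrite hcat_mulmx => /(congr1 dsubmx); rewrite col_mxKd => <-.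
rewrite linear_sum; apply: eq_bigr => j _.
by rewrite linearZ/= col_mxKd.
Qed.

Variable T : 'M[R]_(eta, stackdim m l + eta).
Hypothesis hT : forall xi u y, lifted_traj A B C xi u y ->
  forall t, (l <= t)%N -> xi t = T *m zvec Gamma u y t.

(** Invertibility of [S] makes any vector the value of [zvec] at time [l] on a lifted trajectory
    with prescribed later inputs. Orbits in [z] are thus windows of lifted trajectories, and they
    decay as soon as inputs and outputs do. *)
Lemma z_state_space : exists (Abar : 'M[R]_(stackdim m l + eta))
    (Bbar : 'M[R]_(stackdim m l + eta, m)) (Cbar : 'M[R]_(p, stackdim m l + eta)),
  [/\ forall xi u y, lifted_traj A B C xi u y -> forall t,
        zvec Gamma u y (l + t.+1) =
          Abar *m zvec Gamma u y (l + t) + Bbar *m u (l + t)%N /\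
        y (l + t)%N = Cbar *m zvec Gamma u y (l + t),
      forall z u, lin_dyn Abar Bbar z u ->
        (fun t => Cbar *m z t) @ \oo --> (0 : 'cV[R]_p) ->
        u @ \oo --> (0 : 'cV[R]_m) ->
        z @ \oo --> (0 : 'cV[R]_(stackdim m l + eta))
    & forall z0, exists z u, [/\ z 0%N = z0, lin_dyn Abar Bbar z u
        & z @ \oo --> (0 : 'cV[R]_(stackdim m l + eta))]].
Proof.
have [S [x0 [Su SP span]]] := initial_data_bijective.
have [S' [U S'P]] := zvec_next_from_initial_data A B C Gamma.
pose Abar := S' *m invmx S.
have real xi u y : lifted_traj A B C xi u y -> forall t,
    zvec Gamma u y (l + t.+1) =
      Abar *m zvec Gamma u y (l + t) + U *m u (l + t)%N /\
    y (l + t)%N = C *m T *m zvec Gamma u y (l + t).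
  move=> xuy t; split; last first.
    by rewrite (xuy _).2 (hT xuy) ?leq_addr// mulmxA.
  have xuyt := lifted_traj_shift t xuy.
  have -> : zvec Gamma u y (l + t.+1) = zvec Gamma (fun i => u (t + i)%N)
      (fun i => y (t + i)%N) l.+1.
    by apply: eq_zvec => i _; rewrite addKn subSnn add1n addSnnS.
  have -> : zvec Gamma u y (l + t) = zvec Gamma (fun i => u (t + i)%N)
      (fun i => y (t + i)%N) l.
    by apply: eq_zvec => i _; rewrite addKn subnn.
  by rewrite (S'P _ _ _ xuyt) (SP _ _ _ xuyt) /Abar -mulmxA mulKmx// (addnC t l).
have start (z0 : 'cV[R]_(stackdim m l + eta)) v : exists xi u y,
    [/\ lifted_traj A B C xi u y, zvec Gamma u y l = z0
      & forall t, u (l + t)%N = v t].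
  have [xi [u [y [xuy ini uv]]]] := lifted_traj_of_initial_data A B C (invmx S *m z0) v.
  by exists xi, u, y; split=> //; rewrite (SP _ _ _ xuy) ini mulKVmx.
exists Abar, U, (C *m T); split=> // [z v zv Cz0 v0|z0].
  have [xi [u [y [xuy zl uv]]]] := start (z 0%N) v.
  have zE : z = (fun t => zvec Gamma u y (l + t)).
    apply/funext; elim=> [|t IH]; first by rewrite addn0 zl.
    by rewrite zv (real _ _ _ xuy t).1 -IH uv.
  rewrite zE; apply: zvec_cvg0.
    rewrite -(cvg_shiftn l).
    by under eq_fun do rewrite addnC uv.
  rewrite -(cvg_shiftn l).
  have -> : (fun t => y (t + l)%N) = (fun t => C *m T *m z t).
    by apply/funext => t; rewrite addnC (real _ _ _ xuy t).2 zE.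
  exact: Cz0.
(* [T *m z0] is the lifted state at time [l], where control begins. *)
have [c xi0E] := span (T *m z0).
have [xi' [v [xi'0 xi'S xi'c vc]]] := lifted_stabilizable fcont hcont f00 h0 obs stab x0 c.
have [xi [u [y [xuy zl uv]]]] := start z0 v.
exists (fun t => zvec Gamma u y (l + t)), v; split.
- by rewrite addn0.
- by move=> t; rewrite (real _ _ _ xuy t).1 uv.
have xiE t : xi (l + t)%N = xi' t.
  elim: t => [|t IH]; first by rewrite addn0 (hT xuy)// zl xi0E xi'0.
  by rewrite addnS (xuy _).1 IH uv xi'S.
apply: zvec_cvg0; rewrite -(cvg_shiftn l).
  by under eq_fun do rewrite addnC uv.
have -> : (fun t => y (t + l)%N) = (fun t => C *m xi' t).
  by apply/funext => t; rewrite addnC (xuy _).2 xiE.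
by rewrite -(mulmx0 _ C); exact: cvg_mulmxr.
Qed.
End Realization.
End KoopmanSystem.

(** * The equation for Theta *)

Section ThetaEquation.
Variables (R : realType) (q m p : nat).
Variables (A : 'M[R]_q) (B : 'M[R]_(q, m)) (C : 'M[R]_(p, q)).
Variables (Q : 'M[R]_p) (Ru : 'M[R]_m).
Hypotheses (Qsym : Q^T = Q) (Qpos : posdefmx Q).
Hypotheses (Rusym : Ru^T = Ru) (Rupos : posdefmx Ru).
Implicit Types (P : 'M[R]_q) (K : 'M[R]_(m, q)) (Theta : 'M[R]_(q + m)).

Definition feedback_mx K : 'M[R]_(q + m, q) := col_mx 1%:M (- K).

Definition step_mx : 'M[R]_(q, q + m) := row_mx A B.

(** The Q-function of the cost-to-go [P]: stage cost plus cost of the next state, as a form in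
    [(z, u)]. *)
Definition theta_mx P : 'M[R]_(q + m) :=
  block_mx (C^T *m Q *m C) 0 0 Ru + step_mx^T *m P *m step_mx.

Definition theta_fix K Theta : Prop :=
  Theta = block_mx (C^T *m Q *m C) 0 0 Ru +
    (feedback_mx K *m step_mx)^T *m Theta *m (feedback_mx K *m step_mx).

(** Reversing the product in [theta_fix] gives the closed loop, so the stability of the latter
    governs the equation for [Theta]. *)
Lemma step_feedback K : step_mx *m feedback_mx K = cl_mx A B K.
Proof. by rewrite mul_row_col mulmx1 mulmxN. Qed.

Lemma theta_mxE P : theta_mx P =
  block_mx (C^T *m Q *m C + A^T *m P *m A) (A^T *m P *m B)
           (B^T *m P *m A) (hess B Ru P).
Proof.
rewrite /theta_mx /step_mx tr_row_mx mul_col_mx mul_col_row add_block_mx.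
by rewrite !add0r.
Qed.

(** The difference is [D = G^T (J^T D J) G], and [J^T D J] solves the homogeneous Stein equation of
    [G J], the closed loop. *)
Lemma theta_fix_uniq K Theta Theta' : stable (cl_mx A B K) ->
  theta_fix K Theta -> theta_fix K Theta' -> Theta = Theta'.
Proof.
move=> Kst KT KT'; apply/eqP; rewrite -subr_eq0.
set J := feedback_mx K; set G := step_mx; set D := Theta - Theta'.
have DE : D = G^T *m (J^T *m D *m J) *m G.
  rewrite {1}/D {1}KT KT' opprD addrACA subrr add0r -/J -/G.
  by rewrite -mulmxBl -mulmxBr trmx_mul !mulmxA.
suff E0 : J^T *m D *m J = 0 by rewrite DE E0 mulmx0 mul0mx.
apply: (stein_inj Kst); rewrite -step_feedback -/J -/G {1}DE trmx_mul.
by rewrite !mulmxA.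
Qed.

Lemma theta_mx_fix K P :
  P = C^T *m Q *m C + K^T *m Ru *m K + (cl_mx A B K)^T *m P *m cl_mx A B K ->
  theta_fix K (theta_mx P).
Proof.
move=> PE; rewrite /theta_fix {1}/theta_mx; congr (_ + _).
(* Restricting the Q-function to [u = - K z] gives back the cost of [K]. *)
suff JP : (feedback_mx K)^T *m theta_mx P *m feedback_mx K = P.
  by rewrite -[in LHS]JP trmx_mul !mulmxA.
rewrite [RHS]PE /theta_mx mulmxDr mulmxDl -step_feedback trmx_mul !mulmxA.
congr (_ + _); rewrite /feedback_mx tr_col_mx mul_row_block mul_row_col.
have KN : (- K)^T = - K^T by rewrite linearN.
by rewrite trmx1 !mul1mx !mulmx0 !addr0 add0r mulmx1 KN mulNmx mulmxN mulNmx opprK.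
Qed.

Lemma gain_update_theta P K : P^T = P -> psdmx P ->
  gain_update (theta_mx P) K <-> is_gain A B Ru P K.
Proof.
move=> Psym P0; have Su := posdef_unit (hess_posdef B Rupos P0).
rewrite theta_mxE; split.
  move=> [Tzz [Tuz [Tuu [/eq_block_mx[_ _ <- <-] _ ->]]]].
  by rewrite /is_gain mulKVmx.
move=> PK; exists (C^T *m Q *m C + A^T *m P *m A), (B^T *m P *m A), (hess B Ru P).
split=> //; last by rewrite -PK mulKmx.
by rewrite !trmx_mul trmxK Psym mulmxA.
Qed.

Lemma theta_solution K : stable (cl_mx A B K) -> exists P,
  [/\ P^T = P, psdmx P, lyap A B C Q Ru K P
    & forall Theta, theta_fix K Theta <-> Theta = theta_mx P].
Proof.
move=> Kst.
have [P PE] := stein_solvable (C^T *m Q *m C + K^T *m Ru *m K) Kst.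
have KP := lyapE PE; exists P; split=> //.
- exact: stein_sym Kst (stage_mx_sym C Qsym Rusym K) PE.
- exact: (lyap_psd Qpos Rupos Kst KP).
- move=> Theta; split=> [KT|->]; last exact: theta_mx_fix.
  exact: theta_fix_uniq Kst KT (theta_mx_fix PE).
Qed.
End ThetaEquation.

(** * From the data matrices to the model *)

Section DataEquation.
Variables (R : realType) (n m p eta l nu : nat).
Variables (f : 'cV[R]_n -> 'cV[R]_m -> 'cV[R]_n) (h : 'cV[R]_n -> 'cV[R]_p).
Variables (ud : 'I_nu -> nat -> 'cV[R]_m) (yd : 'I_nu -> nat -> 'cV[R]_p).
Variable Gamma : 'M[R]_(eta, stackdim p l).
Hypothesis data : data_traj l f h ud yd.

Lemma data_realization A B C : z_realization f h Gamma A B C -> forall j,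
  zvec Gamma (ud j) (yd j) l.+1 =
    A *m zvec Gamma (ud j) (yd j) l + B *m ud j l /\
  yd j l = C *m zvec Gamma (ud j) (yd j) l.
Proof.
move=> real j; have [x [y xyP]] := data_traj_extend data.
have [xj yj] := xyP j; have [zS yC] := real _ _ _ xj l (leqnn l).
have -> : zvec Gamma (ud j) (yd j) l.+1 = zvec Gamma (ud j) (y j) l.+1.
  by apply: eq_zvec => // i il; rewrite subSnn yj.
have -> : zvec Gamma (ud j) (yd j) l = zvec Gamma (ud j) (y j) l.
  by apply: eq_zvec => // i il; rewrite subnn yj// ltnW.
by rewrite yj.
Qed.

Variable k : 'I_(mudim m l eta) -> 'I_nu.
Hypothesis Zunit : Zmx Gamma ud yd k \in unitmx.

(** Both [[A B]] agree on the columns of the invertible [Z]. This matters because [stabilizing_gain]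
    refers to an unspecified realization. *)
Lemma z_realization_uniq A B C A' B' C' : z_realization f h Gamma A B C ->
  z_realization f h Gamma A' B' C' -> A = A' /\ B = B'.
Proof.
move=> real real'; apply: eq_row_mx; rewrite -[LHS](mulmxK Zunit) -[RHS](mulmxK Zunit).
congr (_ *m _); rewrite !mulmx_hcat; congr hcat; apply/funext => j.
rewrite !mul_row_col.
by rewrite -(data_realization real (k j)).1 (data_realization real' (k j)).1.
Qed.

Variables (A : 'M[R]_(stackdim m l + eta)) (B : 'M[R]_(stackdim m l + eta, m)).
Variable C : 'M[R]_(p, stackdim m l + eta).
Hypothesis real : z_realization f h Gamma A B C.
Variables (Q : 'M[R]_p) (Ru : 'M[R]_m).

(** [Sigma] and [W] are fixed matrices times [Z], so the invertible [Z] cancels on both sides. *)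
Lemma theta_eqE K Theta :
  theta_eq Q Ru Gamma ud yd k K Theta <-> theta_fix A B C Q Ru K Theta.
Proof.
have SE : Sigmamx Gamma ud yd k K =
    feedback_mx K *m step_mx A B *m Zmx Gamma ud yd k.
  rewrite -mulmxA !mulmx_hcat; congr hcat; apply/funext => j.
  rewrite mul_row_col -(data_realization real (k j)).1 mul_col_mx mul1mx.
  by rewrite mulNmx.
have WE : Wmx l ud yd k = block_mx C 0 0 1%:M *m Zmx Gamma ud yd k.
  rewrite !mulmx_hcat; congr hcat; apply/funext => j.
  by rewrite mul_block_col !mul0mx mul1mx addr0 add0r (data_realization real (k j)).2.
rewrite /theta_eq /theta_fix SE WE.
set Z := Zmx _ _ _ _; set F := feedback_mx K *m _.
have -> : (block_mx C 0 0 1%:M *m Z)^T *m block_mx Q 0 0 Ru *m (block_mx C 0 0 1%:M *m Z) +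
    (F *m Z)^T *m Theta *m (F *m Z) =
    Z^T *m (block_mx (C^T *m Q *m C) 0 0 Ru + F^T *m Theta *m F) *m Z.
  rewrite mulmxDr mulmxDl; congr (_ + _); last by rewrite trmx_mul !mulmxA.
  rewrite trmx_mul !mulmxA; congr (_ *m _); rewrite -!mulmxA; congr (_ *m _).
  rewrite tr_block_mx !mulmx_block !trmx0 trmx1 !mul0mx !mulmx0 !mul1mx !mulmx1.
  by rewrite !addr0 !add0r mulmxA mulmx0.
split=> [ZTZ|<-//].
have ZTu : Z^T \in unitmx by rewrite unitmx_tr.
by have := congr1 (mulmx (invmx Z^T)) (congr1 (mulmxr (invmx Z)) ZTZ);
  rewrite /= !mulmxK// !mulKmx.
Qed.
End DataEquation.

(** * Closed loop and cost *)

Section Cost.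
Variables (R : realType) (l : nat) (F : nat -> R).
Hypothesis F0 : forall t, 0 <= F t.

Lemma partial_costE N :
  (\sum_(l <= t < l + N) (F t)%:E)%E = (\sum_(t < N) F (l + t)%N)%:E.
Proof.
rewrite sumEFin; congr EFin.
by rewrite -{1}[l]add0n big_addn addKn big_mkord; apply: eq_bigr => t _; rewrite addnC.
Qed.

Lemma series_le (c : R) : (forall N, \sum_(t < N) F (l + t)%N <= c) ->
  (\sum_(l <= t <oo) (F t)%:E <= c%:E)%E.
Proof.
move=> Fc; apply: lime_le; first by apply: is_cvg_nneseries => t _ _; rewrite lee_fin.
by exists l => // N /= lN; rewrite -(subnKC lN) partial_costE lee_fin.
Qed.

(** If the series diverges the bound is trivial; otherwise its value bounds every partial sum and
    can be taken as [c]. *)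
Lemma le_series (a : R) :
  (forall c, (forall N, \sum_(t < N) F (l + t)%N <= c) -> a <= c) ->
  (a%:E <= \sum_(l <= t <oo) (F t)%:E)%E.
Proof.
move=> aF.
have Fge N : ((\sum_(t < N) F (l + t)%N)%:E <= \sum_(l <= t <oo) (F t)%:E)%E.
  by rewrite -partial_costE; apply: nneseries_lim_ge => t _ _; rewrite lee_fin.
case: (\sum_(l <= t <oo) (F t)%:E)%E Fge => [c|//|] Fge.
- by rewrite lee_fin; apply: aF => N; have := Fge N; rewrite lee_fin.
- exact: leey.
- by have := Fge 0%N; rewrite leeNy_eq.
Qed.
End Cost.

(** * Stabilization and optimality on the nonlinear system *)

Section ClosedLoop.
Variables (R : realType) (n m p eta l : nat).
Variables (f : 'cV[R]_n -> 'cV[R]_m -> 'cV[R]_n) (h : 'cV[R]_n -> 'cV[R]_p).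
Variable Gamma : 'M[R]_(eta, stackdim p l).
Variables (A : 'M[R]_(stackdim m l + eta)) (B : 'M[R]_(stackdim m l + eta, m)).
Variable C : 'M[R]_(p, stackdim m l + eta).
Hypothesis real : z_realization f h Gamma A B C.

Lemma z_lin_dyn x u y : sys_traj f h x u y ->
  lin_dyn A B (fun t => zvec Gamma u y (l + t)) (fun t => u (l + t)%N).
Proof. by move=> xuy t; rewrite addnS (real xuy (leq_addr t l)).1. Qed.

Lemma z_closed_loop K x u y : closed_loop f h Gamma K x u y -> forall t,
  zvec Gamma u y (l + t.+1) = cl_mx A B K *m zvec Gamma u y (l + t).
Proof.
move=> [xuy uK] t; rewrite (z_lin_dyn xuy t) uK ?leq_addr//.
by rewrite /cl_mx mulmxBl mulmxN mulmxA.
Qed.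

Lemma stable_stabilizes K : detectable f h -> stable (cl_mx A B K) ->
  stabilizes f h Gamma K.
Proof.
move=> det Kst x u y xuyK; have xuy := xuyK.1.
apply: (det _ _ _ xuy); rewrite -(cvg_shiftn l).
have -> : (fun t => y (t + l)%N) = (fun t => C *m zvec Gamma u y (l + t)).
  by apply/funext => t; rewrite addnC (real xuy (leq_addr t l)).2.
by rewrite -(mulmx0 _ C); apply: cvg_mulmxr; apply: Kst; exact: z_closed_loop xuyK.
Qed.

Variables (Q : 'M[R]_p) (Ru : 'M[R]_m).
Hypotheses (Qpos : posdefmx Q) (Rupos : posdefmx Ru).

(** The value of [P] at [z_l] separates the two costs: the Lyapunov equation telescopes along the
    closed loop, and [Popt] bounds the competitor from below. *)
Lemma optimal_minimizes K P : psdmx P -> lyap A B C Q Ru K P ->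
  (forall z u (c : R), lin_dyn A B z u ->
    (forall N, \sum_(t < N) stage_cost C Q Ru (z t) (u t) <= c) ->
    quadform P (z 0%N) <= c) ->
  minimizes_cost f h Q Ru Gamma K.
Proof.
move=> P0 KP Popt x u y xuyK x' u' y' xuy' x'l; have xuy := xuyK.1.
have cost0 (v : nat -> 'cV[R]_m) (w : nat -> 'cV[R]_p) t :
    0 <= quadform Q (w t) + quadform Ru (v t).
  by rewrite addr_ge0// posdef_psd.
have stageE v w x1 : sys_traj f h x1 v w -> forall t,
    quadform Q (w (l + t)%N) + quadform Ru (v (l + t)%N) =
    stage_cost C Q Ru (zvec Gamma v w (l + t)) (v (l + t)%N).
  by move=> xvw t; rewrite (real xvw (leq_addr t l)).2.
apply: (@le_trans _ _ (quadform P (zvec Gamma u y (l + 0)))%:E).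
  apply: series_le => [t|N]; first exact: cost0.
  suff : \sum_(t < N) (quadform Q (y (l + t)%N) + quadform Ru (u (l + t)%N)) +
      quadform P (zvec Gamma u y (l + N)) = quadform P (zvec Gamma u y (l + 0)).
    by move=> <-; rewrite lerDl.
  elim: N => [|N IH]; first by rewrite big_ord0 add0r.
  rewrite big_ord_recr/= -addrA -IH; congr (_ + _).
  rewrite (z_closed_loop xuyK) (KP (zvec _ _ _ (l + N))) (stageE _ _ _ xuy).
  by rewrite xuyK.2 ?leq_addr// stage_costN.
(* The competitor is grafted onto the past of the optimal trajectory. *)
pose x2 t := if (t <= l)%N then x t else x' t.
pose u2 t := if (t < l)%N then u t else u' t.
have xuy2 : sys_traj f h x2 u2 (fun t => h (x2 t)).
  move=> t; split=> //; rewrite /x2 /u2.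
  case: ltngtP => [tl|lt|->].
  - by rewrite (xuy t).1.
  - by rewrite (xuy' t).1.
  - by rewrite (xuy' l).1 x'l.
have x2l t : x2 (l + t)%N = x' (l + t)%N.
  rewrite /x2; case: t => [|t]; first by rewrite addn0 leqnn x'l.
  by rewrite addnS ltnNge leq_addr.
have -> : zvec Gamma u y (l + 0) = zvec Gamma u2 (fun t => h (x2 t)) (l + 0).
  rewrite addn0; apply: eq_zvec => i il; rewrite subnn add0n.
    by rewrite /u2 il.
  by rewrite /x2 (ltnW il) (xuy i).2.
apply: le_series => [t|c cF]; first exact: cost0.
apply: (Popt _ _ _ (z_lin_dyn xuy2)) => N; apply: le_trans (cF N).
rewrite ler_sum// => t _; rewrite -(stageE _ _ _ xuy2) x2l (xuy' _).2.
by rewrite /u2 ltnNge leq_addr.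
Qed.
End ClosedLoop.

(** * Regulation and policy iteration for the nonlinear system *)

Theorem theorem2 (R : realType) (n m p eta l nu : nat)
    (f : 'cV[R]_n -> 'cV[R]_m -> 'cV[R]_n) (h : 'cV[R]_n -> 'cV[R]_p)
    (fcont : continuous (fun w : 'cV[R]_n * 'cV[R]_m => f w.1 w.2))
    (hcont : continuous h) (f00 : f 0 0 = 0) (h0 : h 0 = 0)
    (psi : 'I_eta -> 'cV[R]_n -> R)
    (A : 'M[R]_eta) (B : 'M[R]_(eta, m)) (C : 'M[R]_(p, eta))
    (kle : koopman_embedding f h psi A B C)
    (obs : observable A C) (lag : is_lag A C l)
    (Q : 'M[R]_p) (Ru : 'M[R]_m)
    (Qsym : Q^T = Q) (Qpos : posdefmx Q)
    (Rusym : Ru^T = Ru) (Rupos : posdefmx Ru)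
    (stab : stabilizable f) (detect : detectable f h)
    (ud : 'I_nu -> nat -> 'cV[R]_m) (yd : 'I_nu -> nat -> 'cV[R]_p)
    (data : data_traj l f h ud yd)
    (pe : persistently_excited eta l ud yd)
    (Gamma : 'M[R]_(eta, stackdim p l))
    (alg1 : gamma_from_data ud yd Gamma)
    (hT : exists T : 'M[R]_(eta, stackdim m l + eta),
        row_free T /\
        forall (xi : nat -> 'cV[R]_eta) (u : nat -> 'cV[R]_m)
               (y : nat -> 'cV[R]_p),
          lifted_traj A B C xi u y ->
          forall t, (l <= t)%N -> xi t = T *m zvec Gamma u y t) :
  exists Kstar : 'M[R]_(m, stackdim m l + eta),
    [/\ stabilizes f h Gamma Kstar,
        minimizes_cost f h Q Ru Gamma Kstar
      & forall (k : 'I_(mudim m l eta) -> 'I_nu)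
               (K0 : 'M[R]_(m, stackdim m l + eta)),
          Zmx Gamma ud yd k \in unitmx ->
          stabilizing_gain f h Gamma K0 ->
          (exists (K : nat -> 'M[R]_(m, stackdim m l + eta))
                  (Theta : nat -> 'M[R]_(mudim m l eta)),
             algorithm_run Q Ru Gamma ud yd k K0 K Theta) /\
          (forall (K : nat -> 'M[R]_(m, stackdim m l + eta))
                  (Theta : nat -> 'M[R]_(mudim m l eta)),
             algorithm_run Q Ru Gamma ud yd k K0 K Theta ->
             [/\ forall i, exists! Theta' : 'M[R]_(mudim m l eta),
                   theta_eq Q Ru Gamma ud yd k (K i) Theta',
                 forall i, stabilizes f h Gamma (K i),
                 exists c : R, forall i,
                   `|K i.+1 - Kstar| <= c * `|K i - Kstar| ^+ 2
               & K @ \oo --> Kstar])].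
Proof.
have [T [_ hT']] := hT.
have [Ab [Bb [Cb [lreal zdet znull]]]] :=
  z_state_space kle fcont hcont f00 h0 obs stab data alg1 hT'.
have real : z_realization f h Gamma Ab Bb Cb.
  move=> x u y xuy t lt; have := lreal _ _ _ (koopman_lifted kle xuy) (t - l)%N.
  by rewrite addnS subnKC.
have [P [Kstar [Psym P0 PK KP Popt]]] := riccati_solution Cb Qsym Qpos Rusym Rupos znull.
have Kst := lyap_stable Qsym Qpos Rusym Rupos zdet P0 KP.
exists Kstar; split.
- exact: (stable_stabilizes real detect Kst).
- exact: (optimal_minimizes real Qpos Rupos P0 KP Popt).
move=> k K0 Zu [A' [B' [C' [real' K0schur]]]].
(* [K0] is stabilizing for some realization, which uniqueness identifies with the constructed
   one. *)
have K0st : stable (cl_mx Ab Bb K0).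
  have [-> ->] := z_realization_uniq data Zu real real'.
  exact: schur_stable.
have step K : stable (cl_mx Ab Bb K) -> exists S,
    [/\ S^T = S, lyap Ab Bb Cb Q Ru K S,
      forall Theta, theta_eq Q Ru Gamma ud yd k K Theta <->
        Theta = theta_mx Ab Bb Cb Q Ru S
    & forall K', gain_update (theta_mx Ab Bb Cb Q Ru S) K' <->
        is_gain Ab Bb Ru S K'].
  move=> Kstab; have [S [Ssym S0 KS ST]] := theta_solution Cb Qsym Qpos Rusym Rupos Kstab.
  exists S; split=> // [ Theta|K'].
    by split=> [/(theta_eqE data Zu real)/ST|/ST/(theta_eqE data Zu real)].
  exact: gain_update_theta.
split.
  (* One iteration as a total function; gains that are not stable get the default [(0, 0)], which
     the run from [K0] never meets. *)
  have /choice[F FP] : forall K, exists TK, stable (cl_mx Ab Bb K) ->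
      [/\ theta_eq Q Ru Gamma ud yd k K TK.1, gain_update TK.1 TK.2
        & stable (cl_mx Ab Bb TK.2)].
    move=> K; have [Kstab|] := pselect (stable (cl_mx Ab Bb K)); last first.
      by exists (0, 0).
    have [S [Ssym KS ST SK]] := step K Kstab.
    have SG := gainP Ab Bb Rupos (lyap_psd Qpos Rupos Kstab KS).
    exists (theta_mx Ab Bb Cb Q Ru S, gain Ab Bb Ru S) => _; split.
    - exact/ST.
    - exact/SK.
    - exact: (policy_improvement Qsym Qpos Rusym Rupos zdet Kstab Ssym KS SG).
  pose K i := iter i (fun K => (F K).2) K0.
  have Ki i : stable (cl_mx Ab Bb (K i)).
    by elim: i => //= i IH; have [] := FP _ IH.
  (* The predecessor appears because [Theta i.+1] is computed from [K i]. *)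
  exists K, (fun i => (F (K i.-1)).1); split=> // i.
  by have [] := FP _ (Ki i).
move=> K Theta [K0E run].
have Ki i : stable (cl_mx Ab Bb (K i)).
  elim: i => [|i IH]; first by rewrite K0E.
  have [S [Ssym KS ST SK]] := step _ IH; have [/ST -> /SK SG] := run i.
  exact: (policy_improvement Qsym Qpos Rusym Rupos zdet IH Ssym KS SG).
have /choice[S SP] : forall i, exists S, [/\ S^T = S, lyap Ab Bb Cb Q Ru (K i) S
    & is_gain Ab Bb Ru S (K i.+1)].
  move=> i; have [S [Ssym KS ST SK]] := step _ (Ki i).
  by exists S; have [/ST -> /SK] := run i.
have Ssym i : (S i)^T = S i by have [] := SP i.
have KS i : lyap Ab Bb Cb Q Ru (K i) (S i) by have [] := SP i.
have SK i : is_gain Ab Bb Ru (S i) (K i.+1) by have [] := SP i.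
split.
- move=> i; have [S' [_ _ ST _]] := step _ (Ki i).
  exists (theta_mx Ab Bb Cb Q Ru S'); split; first exact/ST.
  by move=> Theta' /ST.
- by move=> i; exact: (stable_stabilizes real detect (Ki i)).
- exact: (policy_iteration_rate Qsym Qpos Rusym Rupos zdet Psym P0 PK KP Ki Ssym KS SK).
- exact: (policy_iteration_cvg Qsym Qpos Rusym Rupos zdet Psym P0 PK KP Ki Ssym KS SK).
Qed.
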